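(* Let $G$ be a countable discrete group and let $X$ be a compact Hausdorff space that is a minimal $G$-space. Then $$\mathrm{Ker}(G\curvearrowright\partial_F(G,X))=\mathrm{Ker}(G\curvearrowright X)\cap \mathrm{Rad}(G).$$
   Context: A $G$-space is a compact Hausdorff space $X$ on which the discrete group $G$ acts by homeomorphisms; it is minimal if every orbit $Gx$ is dense in $X$. $\mathrm{Ker}(G\curvearrowright Y)=\{g\in G: gy=y \text{ for all } y\in Y\}$. $\mathrm{Rad}(G)$ is the amenable radical, the largest normal amenable subgroup of $G$. $G$ acts on $C(X)$ by $(t\cdot f)(x)=f(t^{-1}x)$. Generalized Furstenberg boundary: an extension of $X$ is a $G$-space $Y$ with a continuous $G$-equivariant surjection $\varphi:Y\to X$. It is minimal if $Y$ is minimal, and strongly proximal if for every $x\in X$ and every probability measure $\mu$ on $Y$ with support in $\varphi^{-1}(x)$, the weak*-closure of the orbit $G\mu$ contains a Dirac measure. A $(G,X)$-boundary is a minimal strongly proximal extension of $X$. $\partial_F(G,X)$ denotes the spectrum of the $G$-injective envelope $\mathrm{I}_G(C(X))$ of $C(X)$, which is a commutative unital $G$-$C^*$-algebra containing $C(X)$ $G$-equivariantly. (The $G$-injective envelope is the $G$-injective $G$-operator system containing $C(X)$, unique up to $G$-equivariant isomorphism fixing $C(X)$, such that the only $G$-equivariant unital completely positive self-map restricting to the identity on $C(X)$ is the identity. An object is $G$-injective if it is injective in the category of $G$-operator systems with $G$-equivariant unital completely positive maps.) For $X$ minimal, $\partial_F(G,X)$ is a $(G,X)$-boundary. *)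

(* Defs.v *)
From HB Require Import structures.
From mathcomp Require Import all_boot all_order all_algebra.
From mathcomp Require Import all_classical all_reals topology normedtype.
From mathcomp Require Import complex ring.

Set Implicit Arguments.
Unset Strict Implicit.
Unset Printing Implicit Defensive.

Import Order.TTheory GRing.Theory Num.Theory.
Import numFieldNormedType.Exports.

Local Open Scope classical_set_scope.
Local Open Scope complex_scope.
Local Open Scope ring_scope.

Record normal_subgroup (G : groupType) (N : set G) : Prop := {
  nsg1 : N 1%g;
  nsgM : forall g h, N g -> N h -> N (g * h)%g;
  nsgV : forall g, N g -> N g^-1%g;
  nsgJ : forall g h, N h -> N (g * h * g^-1)%g }.

Definition bounded_on (T : Type) (R : realType) (H : set T) (f : T -> R) :=
  exists r : R, forall h, H h -> `|f h| <= r.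

(* A left-invariant mean on l^oo(H). A bounded function on H is represented by
   any function on G that extends it: by linearity and [im_ge0] the value of
   [m] depends only on the restriction to H. *)
Record invariant_mean (G : groupType) (R : realType) (H : set G)
    (m : (G -> R) -> R) : Prop := {
  im_add : forall f f', bounded_on H f -> bounded_on H f' ->
    m (fun x => f x + f' x) = m f + m f';
  im_scale : forall c f, bounded_on H f -> m (fun x => c * f x) = c * m f;
  im_ge0 : forall f, bounded_on H f -> (forall h, H h -> 0 <= f h) -> 0 <= m f;
  im_one : m (fun=> 1) = 1;
  im_inv : forall h f, H h -> bounded_on H f -> m (fun x => f (h * x)%g) = m f }.

Definition amenable (R : realType) (G : groupType) (H : set G) : Prop :=
  exists m : (G -> R) -> R, invariant_mean H m.

(* N is the largest normal amenable subgroup of G. *)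
Record amenable_radical (R : realType) (G : groupType) (N : set G) : Prop := {
  arad_normal : normal_subgroup N;
  arad_amenable : amenable R N;
  arad_largest : forall M : set G,
    normal_subgroup M -> amenable R M -> M `<=` N }.

Definition action_kernel (G : groupType) (T : Type) (act : G -> T -> T)
  (Y : set T) : set G := [set g | forall y, Y y -> act g y = y].

(* The point of a ptopologicalType only expresses that the space is nonempty. *)
Record gspace (G : groupType) := GSpace {
  gspace_sort :> ptopologicalType;
  gspace_compact : compact [set: gspace_sort];
  gspace_hausdorff : hausdorff_space gspace_sort;
  gmove : G -> gspace_sort -> gspace_sort;
  gmove1 : forall x, gmove 1%g x = x;
  gmoveM : forall g h x, gmove (g * h)%g x = gmove g (gmove h x);
  gmove_continuous : forall g, continuous (gmove g) }.

Definition minimal_gspace (G : groupType) (X : gspace G) : Prop :=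
  forall x : X, dense (range (fun g => gmove g x)).

Section MatrixOps.
Context {R : realType} {V : lmodType R[i]}.

Definition hermitian_mx (star : V -> V) n (A : 'M[V]_n) : Prop :=
  forall i j, A i j = star (A j i).

Definition diag_unit (e : V) n : 'M[V]_n := \matrix_(i, j) (e *+ (i == j)).

(* alpha^* A alpha, for a scalar matrix alpha *)
Definition compress m n (alpha : 'M[R[i]]_(m, n)) (A : 'M[V]_m) : 'M[V]_n :=
  \matrix_(i, j) \sum_k \sum_l ((alpha k i)^* * alpha l j) *: A k l.

End MatrixOps.

(* A *-vector space with a matrix ordering [mpos] (the cones of positive
   elements of the M_n(V)) and an Archimedean matrix order unit [ounit]. *)
Record opsystem (R : realType) := OpSystem {
  opsys_sort :> lmodType R[i];
  star : opsys_sort -> opsys_sort;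
  ounit : opsys_sort;
  mpos : forall n, set 'M[opsys_sort]_n;
  starK : forall a, star (star a) = a;
  starD : forall a b, star (a + b) = star a + star b;
  starZ : forall (c : R[i]) a, star (c *: a) = c^* *: star a;
  star_unit : star ounit = ounit;
  mpos_herm : forall n (A : 'M[opsys_sort]_n), mpos A -> hermitian_mx star A;
  mpos_add : forall n (A B : 'M[opsys_sort]_n), mpos A -> mpos B -> mpos (A + B);
  mpos_compress : forall m n (alpha : 'M[R[i]]_(m, n)) (A : 'M[opsys_sort]_m),
    mpos A -> mpos (compress alpha A);
  mpos_proper : forall n (A : 'M[opsys_sort]_n), mpos A -> mpos (- A) -> A = 0;
  mpos_unit : forall n (A : 'M[opsys_sort]_n), hermitian_mx star A ->
    exists2 r : R, 0 < r & mpos (diag_unit (r%:C *: ounit) n + A);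
  mpos_archi : forall n (A : 'M[opsys_sort]_n), hermitian_mx star A ->
    (forall r : R, 0 < r -> mpos (diag_unit (r%:C *: ounit) n + A)) -> mpos A }.

Record ucp (R : realType) (S T : opsystem R) (f : S -> T) : Prop := {
  ucp_linear : linear f;
  ucp_unit : f (ounit S) = ounit T;
  ucp_pos : forall n (A : 'M[S]_n), mpos A -> mpos (map_mx f A) }.

(* Unital complete order embedding: f identifies S with an operator subsystem
   of T (injectivity follows from [mpos_proper]). *)
Record opsys_embedding (R : realType) (S T : opsystem R) (f : S -> T) : Prop := {
  emb_ucp : ucp f;
  emb_reflect : forall n (A : 'M[S]_n), mpos (map_mx f A) -> mpos A }.

(* Since [gact g] and its inverse [gact g^-1] are both ucp, G acts by unital
   complete order automorphisms. *)
Record gopsystem (G : groupType) (R : realType) := GOpSystem {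
  gopsys_sort :> opsystem R;
  gact : G -> gopsys_sort -> gopsys_sort;
  gact1 : forall a, gact 1%g a = a;
  gactM : forall g h a, gact (g * h)%g a = gact g (gact h a);
  gact_ucp : forall g, ucp (gact g) }.

Definition equivariant (G : groupType) (R : realType) (S T : gopsystem G R)
  (f : S -> T) : Prop := forall g a, f (gact g a) = gact g (f a).

Definition g_ucp (G : groupType) (R : realType) (S T : gopsystem G R)
  (f : S -> T) : Prop := ucp f /\ equivariant f.

Definition g_embedding (G : groupType) (R : realType) (S T : gopsystem G R)
  (f : S -> T) : Prop := opsys_embedding f /\ equivariant f.

Definition g_injective (G : groupType) (R : realType) (I : gopsystem G R) :=
  forall (S T : gopsystem G R) (k : S -> T) (f : S -> I),
    g_embedding k -> g_ucp f ->
    exists2 F : T -> I, g_ucp F & forall a, F (k a) = f a.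

Record g_injective_envelope (G : groupType) (R : realType)
    (E I : gopsystem G R) (kappa : E -> I) : Prop := {
  genv_embedding : g_embedding kappa;
  genv_injective : g_injective I;
  genv_rigid : forall F : I -> I, g_ucp F ->
    (forall a, F (kappa a) = kappa a) -> forall b, F b = b }.

(* A product and a norm making the G-operator system A a commutative unital
   G-C*-algebra whose matrix cones are those of the C*-algebras M_n(A), i.e.
   consist of the matrices B^* B. *)
Record comm_gcstar (G : groupType) (R : realType) (A : gopsystem G R) := {
  cmul : A -> A -> A;
  cnorm : A -> R;
  cmulA : forall a b c, cmul a (cmul b c) = cmul (cmul a b) c;
  cmulC : forall a b, cmul a b = cmul b a;
  cmul1 : forall a, cmul (ounit A) a = a;
  cmulDl : forall a b c, cmul (a + b) c = cmul a c + cmul b c;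
  cmulZl : forall (z : R[i]) a b, cmul (z *: a) b = z *: cmul a b;
  star_cmul : forall a b, star (cmul a b) = cmul (star b) (star a);
  cnorm_eq0 : forall a, cnorm a = 0 -> a = 0;
  cnormD : forall a b, cnorm (a + b) <= cnorm a + cnorm b;
  cnormZ : forall (z : R[i]) a, cnorm (z *: a) = complex.Re `|z| * cnorm a;
  cnormM : forall a b, cnorm (cmul a b) <= cnorm a * cnorm b;
  cnorm_cstar : forall a, cnorm (cmul (star a) a) = cnorm a ^+ 2;
  cnorm_complete : forall u : nat -> A,
    (forall e : R, 0 < e -> exists N, forall m n,
       (N <= m)%N -> (N <= n)%N -> cnorm (u m - u n) < e) ->
    exists l, forall e : R, 0 < e -> exists N, forall n,
       (N <= n)%N -> cnorm (u n - l) < e;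
  cstar_mpos : forall n (M : 'M[A]_n), mpos M <->
    exists B : 'M[A]_n, M = \matrix_(i, j) \sum_k cmul (star (B k i)) (B k j);
  gact_cmul : forall g a b, gact g (cmul a b) = cmul (gact g a) (gact g b) }.

(* The underlying set of the spectrum: the characters of A. Its topology
   (pointwise convergence) plays no role for the kernel of the action. *)
Definition spectrum (G : groupType) (R : realType) (A : gopsystem G R)
  (cs : comm_gcstar A) : set (A -> R[i]^o) :=
  [set chi | [/\ linear chi, chi (ounit A) = 1
               & forall a b, chi (cmul cs a b) = chi a * chi b]].

Definition spectrum_act (G : groupType) (R : realType) (A : gopsystem G R)
  (g : G) (chi : A -> R[i]^o) : A -> R[i]^o := fun a => chi (gact g^-1%g a).

Section PositiveSemidefinite.
Variable C : numClosedFieldType.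

Definition qform n (A : 'M[C]_n) (v : 'I_n -> C) : C :=
  \sum_i \sum_j (v i)^* * A i j * v j.

Definition psdmx n (A : 'M[C]_n) : Prop :=
  (forall i j, A i j = (A j i)^*) /\ forall v, 0 <= qform A v.

Lemma qformD n (A B : 'M[C]_n) v : qform (A + B) v = qform A v + qform B v.
Proof.
rewrite /qform -big_split; apply: eq_bigr => i _ /=.
rewrite -big_split; apply: eq_bigr => j _ /=.
by rewrite mxE mulrDr mulrDl.
Qed.

Lemma qformN n (A : 'M[C]_n) v : qform (- A) v = - qform A v.
Proof.
rewrite /qform -sumrN; apply: eq_bigr => i _ /=.
rewrite -sumrN; apply: eq_bigr => j _ /=.
by rewrite mxE mulrN mulNr.
Qed.

Lemma qform_scalar n (r : C) v :
  qform (\matrix_(i < n, j < n) (r *+ (i == j))) v = r * \sum_i `|v i| ^+ 2.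
Proof.
rewrite /qform mulr_sumr; apply: eq_bigr => i _.
rewrite (bigD1 i) //= big1 => [|j ji]; last first.
  by rewrite mxE eq_sym (negbTE ji) mulr0n mulr0 mul0r.
by rewrite addr0 mxE eqxx mulr1n normCK mulrAC mulrC (mulrC (v i)).
Qed.

Lemma qform_compress m n (alpha : 'M[C]_(m, n)) (A : 'M[C]_m) v :
  qform (\matrix_(i, j) \sum_k \sum_l ((alpha k i)^* * alpha l j) * A k l) v =
  qform A (fun k => \sum_j alpha k j * v j).
Proof.
rewrite /qform.
under eq_bigr => i _ do under eq_bigr => j _ do rewrite mxE mulr_sumr mulr_suml.
under eq_bigr => i _ do rewrite exchange_big /=.
rewrite exchange_big /=; apply: eq_bigr => k _.
under eq_bigr => i _ do
  under eq_bigr => j _ do rewrite mulr_sumr mulr_suml.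
under eq_bigr => i _ do rewrite exchange_big /=.
rewrite exchange_big /=; apply: eq_bigr => l _.
rewrite rmorph_sum /= mulr_suml mulr_suml; apply: eq_bigr => i _.
rewrite mulr_sumr; apply: eq_bigr => j _.
by rewrite rmorphM /=; ring.
Qed.

Lemma qform_pair n (A : 'M[C]_n) (i j : 'I_n) (c : C) : i != j ->
  qform A (fun k => (k == i)%:R + c *+ (k == j)) =
  A i i + c * A i j + c^* * A j i + c^* * c * A j j.
Proof.
move=> ij; set v := (fun k => _).
have vi : v i = 1 by rewrite /v eqxx (negbTE ij) addr0.
have vj : v j = c by rewrite /v eqxx eq_sym (negbTE ij) add0r.
have v0 k : k != i -> k != j -> v k = 0.
  by rewrite /v => /negbTE -> /negbTE ->; rewrite addr0.
have row k : \sum_l (v k)^* * A k l * v l =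
    (v k)^* * A k i + (v k)^* * A k j * c.
  rewrite (bigD1 i) //= (bigD1 j) ?(eq_sym j) //= big1 => [|l /andP[li lj]].
    by rewrite vi vj mulr1 addr0.
  by rewrite (v0 l) // mulr0.
rewrite /qform (eq_bigr _ (fun k _ => row k)).
rewrite (bigD1 i) //= (bigD1 j) ?(eq_sym j) //= big1 => [|l /andP[li lj]].
  by rewrite vi vj rmorph1; ring.
by rewrite (v0 l) // rmorph0 !mul0r addr0.
Qed.

Lemma psdmx_proper n (A : 'M[C]_n) : psdmx A -> psdmx (- A) -> A = 0.
Proof.
move=> [hA pA] [_ nA].
have q0 v : qform A v = 0.
  by apply/eqP; rewrite eq_le pA andbT -oppr_ge0 -qformN nA.
have d0 i : A i i = 0.
  have := q0 (fun k => (k == i)%:R).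
  rewrite /qform (bigD1 i) //= [X in _ + X]big1 => [|k ki]; last first.
    by rewrite big1 // => l _; rewrite (negbTE ki) rmorph0 !mul0r.
  rewrite addr0 (bigD1 i) //= big1 => [|l li]; last first.
    by rewrite (negbTE li) mulr0.
  by rewrite addr0 !eqxx rmorph1 mul1r mulr1.
apply/matrixP => i j; rewrite mxE.
have [->|ij] := eqVneq i j; first exact: d0.
have := q0 (fun k => (k == i)%:R + (A i j)^* *+ (k == j)).
rewrite qform_pair // !d0 mulr0 addr0 add0r conjCK (hA j i) => /eqP.
rewrite (mulrC (A i j)) -mulr2n mulrn_eq0 /= mulf_eq0 conjC_eq0 orbb.
by move/eqP.
Qed.

Lemma qform_real n (A : 'M[C]_n) v :
  (forall i j, A i j = (A j i)^*) -> qform A v \is Num.real.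
Proof.
move=> hA; apply/CrealP; rewrite /qform rmorph_sum /=.
under eq_bigr => i _ do rewrite rmorph_sum /=.
rewrite exchange_big /=; apply: eq_bigr => i _; apply: eq_bigr => j _.
by rewrite !rmorphM /= conjCK -hA mulrC mulrA mulrAC mulrC.
Qed.

Lemma qform_norm n (A : 'M[C]_n) (b : C) v : (forall i j, `|A i j| <= b) ->
  `|qform A v| <= (b *+ (n + n)) * \sum_i `|v i| ^+ 2.
Proof.
move=> Ab; have key i j :
    `|(v i)^* * A i j * v j| <= b * `|v i| ^+ 2 + b * `|v j| ^+ 2.
  have b0 : 0 <= b by apply: le_trans (Ab i j).
  rewrite -mulrDr !normrM norm_conjC mulrAC mulrC.
  apply: ler_pM => //; first by rewrite mulr_ge0.
  have := real_leif_mean_square_scaled (normr_real (v i)) (normr_real (v j)).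
  by move=> /leif_le; apply: le_trans; rewrite mulr2n lerDl mulr_ge0.
apply: le_trans (ler_norm_sum _ _ _) _.
apply: le_trans (ler_sum _ (fun i _ => le_trans (ler_norm_sum _ _ _)
  (ler_sum _ (fun j _ => key i j)))) _.
under eq_bigr => i _ do rewrite big_split /= sumr_const card_ord -mulr_sumr.
rewrite big_split /= sumr_const card_ord sumrMnl -mulr_sumr.
by rewrite mulrnDr mulrDl !mulrnAl.
Qed.

Lemma psdmxD n (A B : 'M[C]_n) : psdmx A -> psdmx B -> psdmx (A + B).
Proof.
move=> [hA pA] [hB pB]; split=> [i j|v].
  by rewrite !mxE rmorphD /= -hA -hB.
by rewrite qformD addr_ge0.
Qed.

Lemma psdmx_compress m n (alpha : 'M[C]_(m, n)) (A : 'M[C]_m) : psdmx A ->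
  psdmx (\matrix_(i, j) \sum_k \sum_l ((alpha k i)^* * alpha l j) * A k l).
Proof.
move=> [hA pA]; split=> [i j|v]; last by rewrite qform_compress.
rewrite !mxE rmorph_sum /=.
under [RHS]eq_bigr => k _ do rewrite rmorph_sum /=.
rewrite exchange_big /=; apply: eq_bigr => k _; apply: eq_bigr => l _.
by rewrite !rmorphM /= conjCK -hA (mulrC (alpha l i)^*).
Qed.

End PositiveSemidefinite.

Lemma continuous_lincomb (K : numFieldType) (T : topologicalType) (c : K)
  (f g : T -> K^o) : continuous f -> continuous g ->
  continuous (fun x => c *: f x + g x : K^o).
Proof.
move=> cf cg x; apply: cvgD; last exact: cg.
by apply: cvgZl_tmp; exact: cf.
Qed.

Section ContinuousFunctions.
Context {R : realType} {X : topologicalType}.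

Definition cfun_pred : {pred (X -> R[i]^o)} :=
  mem [set f : X -> R[i]^o | continuous f].

Lemma cfun_submod_closed : submod_closed cfun_pred.
Proof.
split=> [|c f g].
  by apply/mem_set => x; exact: cst_continuous.
move=> /set_mem cf /set_mem cg; apply/mem_set.
exact: (@continuous_lincomb R[i] X c f g cf cg).
Qed.
HB.instance Definition _ :=
  GRing.isSubmodClosed.Build R[i] (X -> R[i]^o) cfun_pred cfun_submod_closed.

Record cfun := CFun { cfun_fun :> X -> R[i]^o; _ : cfun_fun \in cfun_pred }.
HB.instance Definition _ := [isSub for cfun_fun].
HB.instance Definition _ := [Choice of cfun by <:].
HB.instance Definition _ := [SubChoice_isSubLmodule of cfun by <:].

Lemma cfun_continuous (f : cfun) : continuous f.
Proof. by have := valP f; rewrite inE. Qed.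

End ContinuousFunctions.
Arguments cfun R X : clear implicits.
Arguments cfun_continuous {R X} f.

Section ContinuousFunctionSystem.
Context {R : realType} {X : ptopologicalType}.
Hypothesis cptX : compact [set: X].
Implicit Types (f : cfun R X) (x : X).

Lemma cfun_sum x (I : Type) (r : seq I) (P : pred I) (F : I -> cfun R X) :
  (\sum_(i <- r | P i) F i) x = \sum_(i <- r | P i) F i x.
Proof. by apply: (big_morph (fun f : cfun R X => f x)). Qed.

Definition cfun_star f : cfun R X.
Proof.
apply: (@CFun _ _ (fun x => (f x : R[i])^* : R[i]^o)).
rewrite inE /= => x; apply/cvgrPdist_lt => e e0.
have /cvgrPdist_lt /(_ e e0) := cfun_continuous f x.
by apply: filterS => y; rewrite -rmorphB /= norm_conjC.
Defined.

Definition cfun_one : cfun R X.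
Proof.
apply: (@CFun _ _ (fun=> 1)); rewrite inE /= => x; exact: cst_continuous.
Defined.

(* M_n(C(X)) = C(X, M_n(C)), ordered pointwise. *)
Definition cfun_mpos n : set 'M[cfun R X]_n :=
  [set A | forall x, psdmx (map_mx (fun f => f x : R[i]) A)].

Lemma cfun_bounded f : exists r : R, forall x, `|f x : R[i]| <= r%:C.
Proof.
pose U (k : nat) := [set x | `|f x : R[i]| < k%:R].
have Uo k : setT k -> open (U k).
  move=> _; have -> : U k = f @^-1` ball (0 : R[i]^o) k%:R.
    by apply/seteqP; split=> x; rewrite /U -ball_normE /= sub0r normrN.
  by apply: open_comp => [x _|]; [exact: cfun_continuous | exact: ball_open].
have cU : [set: X] `<=` cover setT U.
  move=> x _; exists (Num.truncn (complex.Re `|f x : R[i]|)).+1 => //.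
  rewrite /U /= -[X in X < _]RRe_real ?normr_real // -(rmorph_nat (real_complex R)) ltcR.
  exact: truncnS_gt.
have := cptX; rewrite compact_cover => /(_ _ _ _ Uo cU)[D _ DU].
exists (\sum_(k <- finmap.enum_fset D) k)%N%:R => x.
have [k kD kx] := DU x I.
rewrite rmorph_nat; apply: le_trans (ltW kx) _.
by rewrite ler_nat (big_rem k) //= leq_addr.
Qed.

Fact cfun_starK f : cfun_star (cfun_star f) = f.
Proof. by apply/val_inj/funext => x /=; exact: conjCK. Qed.

Fact cfun_starD f g : cfun_star (f + g) = cfun_star f + cfun_star g.
Proof. by apply/val_inj/funext => x; exact: rmorphD. Qed.

Fact cfun_starZ (c : R[i]) f : cfun_star (c *: f) = c^* *: cfun_star f.
Proof. by apply/val_inj/funext => x; exact: rmorphM. Qed.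

Fact cfun_star_one : cfun_star cfun_one = cfun_one.
Proof. by apply/val_inj/funext => x; exact: rmorph1. Qed.

Fact cfun_mpos_herm n (A : 'M[cfun R X]_n) :
  cfun_mpos A -> hermitian_mx cfun_star A.
Proof.
move=> pA i j; apply/val_inj/funext => x.
by have [/(_ i j)] := pA x; rewrite !mxE.
Qed.

Fact cfun_mpos_add n (A B : 'M[cfun R X]_n) :
  cfun_mpos A -> cfun_mpos B -> cfun_mpos (A + B).
Proof.
move=> pA pB x; have := psdmxD (pA x) (pB x).
by congr psdmx; apply/matrixP => i j; rewrite !mxE.
Qed.

Fact cfun_mpos_compress m n (alpha : 'M[R[i]]_(m, n)) (A : 'M[cfun R X]_m) :
  cfun_mpos A -> cfun_mpos (compress alpha A).
Proof.
move=> pA x; have := psdmx_compress alpha (pA x).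
congr psdmx; apply/matrixP => i j; rewrite !mxE cfun_sum.
apply: eq_bigr => k _; rewrite cfun_sum; apply: eq_bigr => l _.
by rewrite mxE.
Qed.

Fact cfun_mpos_proper n (A : 'M[cfun R X]_n) :
  cfun_mpos A -> cfun_mpos (- A) -> A = 0.
Proof.
move=> pA nA; apply/matrixP => i j; rewrite mxE; apply/val_inj/funext => x.
have /matrixP/(_ i j) : map_mx (fun f => f x : R[i]) A = 0.
  apply: psdmx_proper (pA x) _; have := nA x.
  by congr psdmx; apply/matrixP => k l; rewrite !mxE.
by rewrite !mxE.
Qed.

Lemma qform_unit n (A : 'M[cfun R X]_n) (r : R) x v :
  qform (map_mx (fun f => f x : R[i]) (diag_unit (r%:C *: cfun_one) n + A)) v =
  r%:C * (\sum_i `|v i| ^+ 2) + qform (map_mx (fun f => f x : R[i]) A) v.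
Proof.
rewrite -qform_scalar -qformD; congr qform; apply/matrixP => i j.
rewrite !mxE; case: (i == j); rewrite ?mulr1n ?mulr0n //=.
by congr (_ + _); exact: mulr1.
Qed.

Lemma herm_unit n (A : 'M[cfun R X]_n) (r : R) x :
  hermitian_mx cfun_star A -> forall i j,
  map_mx (fun f => f x : R[i]) (diag_unit (r%:C *: cfun_one) n + A) i j =
  (map_mx (fun f => f x : R[i]) (diag_unit (r%:C *: cfun_one) n + A) j i)^*.
Proof.
move=> hA i j; rewrite !mxE hA eq_sym.
case: (j == i); rewrite ?mulr1n ?mulr0n //= rmorphD /=; last first.
  by congr (_ + _); rewrite rmorph0.
congr (_ + _); rewrite rmorphM /= rmorph1.
by congr (_ * _); apply/esym/CrealP; rewrite complex_real.
Qed.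

Fact cfun_mpos_unit n (A : 'M[cfun R X]_n) : hermitian_mx cfun_star A ->
  exists2 r : R, 0 < r & cfun_mpos (diag_unit (r%:C *: cfun_one) n + A).
Proof.
move=> hA.
have /choice[b bP] : forall ij : 'I_n * 'I_n, exists r : R,
    forall x, `|A ij.1 ij.2 x : R[i]| <= r%:C.
  by move=> ij; exact: cfun_bounded.
pose M : R := 1 + \sum_ij `|b ij|.
have M1 : 1 <= M by rewrite lerDl sumr_ge0.
have bM i j x : `|A i j x : R[i]| <= M%:C.
  apply: le_trans (bP (i, j) x) _; rewrite lecR.
  rewrite /M (bigD1 (i, j)) //=; apply: le_trans (ler_norm _) _.
  by rewrite addrCA lerDl addr_ge0 // sumr_ge0.
exists (M *+ (n + n).+1); first by rewrite pmulrn_rgt0 // (lt_le_trans ltr01).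
move=> x; split=> [|v]; first exact: herm_unit.
rewrite qform_unit; set Q := qform _ v; set S := \sum_i _.
have S0 : 0 <= S by apply: sumr_ge0 => i _; rewrite exprn_ge0.
have M0 : 0 <= M%:C by rewrite lecR (le_trans ler01).
have QS : `|Q| <= M%:C *+ (n + n) * S.
  by apply: qform_norm => i j; rewrite mxE.
have Qr : Q \is Num.real.
  by apply: qform_real => i j; rewrite !mxE hA.
rewrite -lerBlDr sub0r; apply: le_trans (_ : `|Q| <= _).
  by rewrite -normrN real_ler_norm // rpredN.
apply: le_trans QS _; apply: ler_wpM2r => //.
by rewrite rmorphMn /= mulrS lerDr.
Qed.

Fact cfun_mpos_archi n (A : 'M[cfun R X]_n) : hermitian_mx cfun_star A ->
  (forall r : R, 0 < r -> cfun_mpos (diag_unit (r%:C *: cfun_one) n + A)) ->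
  cfun_mpos A.
Proof.
move=> hA pA x; split=> [i j|v]; first by rewrite !mxE hA.
set Q := qform _ v.
have Qr : Q \is Num.real by apply: qform_real => i j; rewrite !mxE hA.
pose S := complex.Re (\sum_i `|v i| ^+ 2).
have S0 : 0 <= \sum_i `|v i| ^+ 2 by apply: sumr_ge0 => i _; rewrite exprn_ge0.
have SE : \sum_i `|v i| ^+ 2 = S%:C by rewrite RRe_real // ger0_real.
have QE : Q = (complex.Re Q)%:C by rewrite RRe_real.
rewrite QE lecR; apply/ler_addgt0Pl => e e0.
have S1 : 0 < S + 1 by rewrite ltr_pwDr // -lecR -SE.
have := (pA (e / (S + 1)) (divr_gt0 e0 S1) x).2 v.
rewrite qform_unit SE -/Q QE -rmorphM -rmorphD lecR /=.
move/le_trans; apply; rewrite lerD2r mulrAC ler_pdivrMr //.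
by rewrite ler_pM2l // lerDl.
Qed.

Definition cfun_opsystem : opsystem R :=
  OpSystem cfun_starK cfun_starD cfun_starZ cfun_star_one cfun_mpos_herm
    cfun_mpos_add cfun_mpos_compress cfun_mpos_proper cfun_mpos_unit
    cfun_mpos_archi.

End ContinuousFunctionSystem.

Section GSpaceFunctions.
Context {R : realType} {G : groupType} (X : gspace G).

Let CX : opsystem R := cfun_opsystem (@gspace_compact G X).

Definition cfun_act (g : G) (f : cfun R X) : cfun R X.
Proof.
apply: (@CFun _ _ (fun x => f (gmove g^-1%g x))).
rewrite inE /= => x; apply: continuous_comp; first exact: gmove_continuous.
exact: cfun_continuous.
Defined.

Fact cfun_act1 f : cfun_act 1%g f = f.
Proof. by apply/val_inj/funext => x /=; rewrite invg1 gmove1. Qed.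

Fact cfun_actM g h f : cfun_act (g * h)%g f = cfun_act g (cfun_act h f).
Proof. by apply/val_inj/funext => x /=; rewrite invgM gmoveM. Qed.

Fact cfun_act_ucp g : ucp (cfun_act g : CX -> CX).
Proof.
split=> [a f h||n A pA x]; [exact/val_inj|exact/val_inj|].
have := pA (gmove g^-1%g x).
by congr psdmx; apply/matrixP => i j; rewrite !mxE.
Qed.

Definition cfun_gopsystem : gopsystem G R :=
  @GOpSystem G R CX cfun_act cfun_act1 cfun_actM cfun_act_ucp.

End GSpaceFunctions.
Arguments cfun_gopsystem R {G} X.

(* Main.v *)
Require Import Defs.
From HB Require Import structures.
From mathcomp Require Import all_boot all_order all_algebra.
From mathcomp Require Import all_classical all_reals topology normedtype.
From mathcomp Require Import complex ring lra.

(** Let [K] be the subgroup of [G] acting trivially on [I].  By Gelfand duality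
    the characters of [I] separate its elements, so [K] is the kernel of the
    action on the spectrum ([spectrum_kernel]) and the theorem becomes a
    statement about operator systems: [K] is the intersection of the kernel of
    the action on [X] with the amenable radical.

    Both inclusions compare [I] with the bounded functions on [G * Z], where [Z]
    is the set of states of [I] and [G] acts by translation on the first factor.
    A family of states indexed by [Z] defines a Poisson transform
    [a |-> ((g, z) |-> sigma_z (g^-1 a))], an equivariant ucp map on [I].  For
    the family of all states its restriction [j] to C(X) is a complete order
    embedding ([poisson_embedding]): positivity of a matrix over C(X) is tested
    by the scalar quadratic forms at its points, and positivity of an element of
    [I] is tested by states.  Injectivity of [I] therefore extends the inclusion
    [kappa] of C(X) along [j] to an equivariant ucp map [Psi] from the bounded
    functions to [I].

    Elements of [K] fix the image of C(X), which separates the points of [X], so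
    they fix [X].  They also fix the range of [Psi]; hence a state of [I]
    composed with [Psi] is a mean on [G] invariant under [K], and [K] is amenable
    ([trivial_part_amenable]).  As [K] is normal, it lies in the radical.

    Conversely let [N] be normal, amenable and trivial on [X], and average every
    state over [N].  The averaged states agree with the original ones on C(X),
    so their Poisson transform [P] satisfies [P (kappa f) = j f] and [Psi \o P]
    fixes C(X).  Rigidity makes [Psi \o P] the identity, while [P] is
    [N]-invariant because [N] is normal; thus [N] acts trivially on [I]
    ([amenable_sub_trivial_part]).

    Gelfand duality is derived from the order structure alone.  The positive
    elements of [I] form a preordering, that is, a cone closed under products.
    If the self-adjoint [f] is not positive, then [- f] can be adjoined without
    reaching [-1] ([invertible_pos]); a maximal preordering containing it orders
    the self-adjoint elements totally, and by the Archimedean property this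
    order is the same thing as a character, with a nonpositive value at [f]. *)

Set Implicit Arguments.
Unset Strict Implicit.
Unset Printing Implicit Defensive.

Import Order.TTheory GRing.Theory Num.Theory.
Import numFieldNormedType.Exports.
Local Open Scope complex_scope.
Local Open Scope classical_set_scope.
Local Open Scope ring_scope.

(** * Preorderings of commutative rings *)

Section Preorderings.
Context {R : realType} {A : comPzRingType} (c : {rmorphism R -> A}).
Implicit Types (Q : set A) (a b f s t : A) (r : R).

Record preordering Q : Prop := {
  po_add : forall a b, Q a -> Q b -> Q (a + b);
  po_mul : forall a b, Q a -> Q b -> Q (a * b);
  po_cst : forall r, 0 <= r -> Q (c r) }.

(** [adjoin Q f] is the semiring generated by [Q] and [f] as soon as
    [f * f \in Q], since higher powers of [f] are then absorbed. *)
Definition adjoin Q f : set A :=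
  [set a | exists s t, [/\ Q s, Q t & a = s + f * t]].

Lemma po0 Q : preordering Q -> Q 0.
Proof. by move=> /po_cst /(_ 0 (lexx _)); rewrite rmorph0. Qed.

Lemma po1 Q : preordering Q -> Q 1.
Proof. by move=> /po_cst /(_ 1 ler01); rewrite rmorph1. Qed.

Lemma po_scale Q r a : preordering Q -> 0 <= r -> Q a -> Q (c r * a).
Proof. by move=> pQ r0 Qa; apply: po_mul => //; exact: po_cst. Qed.

Lemma sub_adjoin Q f : preordering Q -> Q `<=` adjoin Q f.
Proof. by move=> pQ a Qa; exists a, 0; split=> //; [exact: po0|ring]. Qed.

Lemma mem_adjoin Q f : preordering Q -> adjoin Q f f.
Proof. by move=> pQ; exists 0, 1; split; [exact: po0|exact: po1|ring]. Qed.

Lemma adjoin_preordering Q f :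
  preordering Q -> Q (f * f) -> preordering (adjoin Q f).
Proof.
move=> pQ Qff; split=> [a b|a b|r r0].
- move=> [s [t [Qs Qt ->]]] [s' [t' [Qs' Qt' ->]]].
  by exists (s + s'), (t + t'); split; [exact: po_add|exact: po_add|ring].
- move=> [s [t [Qs Qt ->]]] [s' [t' [Qs' Qt' ->]]].
  exists (s * s' + f * f * (t * t')), (s * t' + t * s').
  split; [|by apply: (po_add pQ); apply: (po_mul pQ)|ring].
  apply: (po_add pQ); first exact: (po_mul pQ).
  by apply: (po_mul pQ) => //; exact: (po_mul pQ).
- by apply: sub_adjoin => //; exact: po_cst.
Qed.

(** Zorn's lemma is run on the sets [X] for which [Q0 `|` X] is proper, so that
    the empty chain has an upper bound. *)
Lemma maximal_preordering Q0 : preordering Q0 -> ~ Q0 (-1) ->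
  exists Q, [/\ preordering Q, ~ Q (-1), Q0 `<=` Q &
    forall Q', preordering Q' -> ~ Q' (-1) -> Q `<=` Q' -> Q' `<=` Q].
Proof.
move=> pQ0 Q0N1.
pose proper X := preordering (Q0 `|` X) /\ ~ (Q0 `|` X) (-1).
have [F FP Ftot|X [[pX XN1] Xmax]] := @Zorn_bigcup A proper.
- pose U := Q0 `|` \bigcup_(X in F) X.
  have inU X : F X -> Q0 `|` X `<=` U.
    by move=> FX a [Qa|Xa]; [left|right; exists X].
  have pairU a b : U a -> U b -> (Q0 a /\ Q0 b) \/
      exists X, [/\ F X, (Q0 `|` X) a & (Q0 `|` X) b].
    move=> [Qa|[X FX Xa]] [Qb|[Y FY Yb]]; [by left| | |].
    + by right; exists Y; split=> //; [left|right].
    + by right; exists X; split=> //; [right|left].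
    + right; have [XY|YX] := Ftot _ _ FX FY.
        by exists Y; split=> //; right => //; exact: XY.
      by exists X; split=> //; right => //; exact: YX.
  split; last by move=> [|[X FX XN1]] //; apply: (FP X FX).2; right.
  split=> [a b Ua Ub|a b Ua Ub|r r0]; last by left; exact: po_cst.
  + have [[Qa Qb]|[X [FX Xa Xb]]] := pairU a b Ua Ub.
      by left; exact: po_add.
    by apply: (inU X) => //; apply: (po_add (FP X FX).1).
  + have [[Qa Qb]|[X [FX Xa Xb]]] := pairU a b Ua Ub.
      by left; exact: po_mul.
    by apply: (inU X) => //; apply: (po_mul (FP X FX).1).
- exists (Q0 `|` X); split=> // Q' pQ' Q'N1 XQ'.
  have [//|nQ'X] := pselect (Q' `<=` Q0 `|` X).
  have Q'E : Q0 `|` Q' = Q'.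
    by apply/seteqP; split=> a; [case=> [Qa|//]; apply: XQ'; left|right].
  case: (Xmax Q'); last by rewrite /proper Q'E.
  split=> [a Xa|Q'X]; first by apply: XQ'; right.
  by apply: nQ'X => a /Q'X; right.
Qed.

(** If neither [b] nor [- b] could be adjoined, then [b * t = - (1 + s)] and
    [b * t' = 1 + s'] for elements [s], [t], [s'], [t'] of [Q]; the product of
    the two equations writes [-1] as an element of [Q]. *)
Lemma maximal_total Q b : preordering Q -> ~ Q (-1) ->
  (forall Q', preordering Q' -> ~ Q' (-1) -> Q `<=` Q' -> Q' `<=` Q) ->
  Q (b * b) -> Q b \/ Q (- b).
Proof.
move=> pQ QN1 Qmax Qbb.
have grow f : Q (f * f) -> ~ Q f -> adjoin Q f (-1).
  move=> Qff nQf; apply: contrapT => nN1; apply: nQf.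
  apply: (Qmax (adjoin Q f)) => //; first exact: adjoin_preordering.
    exact: sub_adjoin.
  exact: mem_adjoin.
apply: contrapT => /not_orP[nQb nQNb].
have [s [t [Qs Qt E]]] := grow b Qbb nQb.
have [||s' [t' [Qs' Qt' E']]] := grow (- b); rewrite ?mulrNN //.
apply: QN1.
have bt : b * t = - (1 + s) by rewrite opprD E; ring.
have bt' : b * t' = 1 + s'.
  by rewrite -[1]opprK E'; ring.
have -> : -1 = (s + s' + s * s') + (b * b) * (t * t').
  have -> : b * b * (t * t') = (b * t) * (b * t') by ring.
  by rewrite bt bt'; ring.
apply: (po_add pQ); last by apply: (po_mul pQ); last exact: (po_mul pQ).
by apply: (po_add pQ); [exact: po_add|exact: po_mul].
Qed.

(** This is the step that replaces functional calculus.  From [f * p = 1 + s]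
    with [s \in P] one wants to divide by [p], which is only known to be bounded
    above by [k].  The identity in [step] improves a lower bound [- x] of [f]
    to [- x + k^-1]; finitely many improvements reach the bound [0]. *)
Lemma invertible_pos P p f k r : preordering P -> P p -> P (c k - p) ->
  0 < k -> P (c r + f) -> P (f * p - 1) -> P f.
Proof.
move=> pP Pp Pkp k0 Prf Pfp.
have Pk2p : P (c (k + k) - p).
  by rewrite rmorphD /= -addrA; apply: (po_add pP) => //; exact: po_cst (ltW _).
have step x : 0 <= x -> P (c x + f) -> P (c (x - k^-1) + f).
  move=> x0 Px.
  have -> : c (x - k^-1) + f = c (k^-1 * k^-1) *
     ((c k - p) * (c k - p) * (c x + f) + c x * (p * (c (k + k) - p))
      + ((c k - p) + (f * p - 1) * (c (k + k) - p))).
    have kk : c k^-1 * c k = 1 by rewrite -rmorphM mulVf ?rmorph1 // gt_eqF.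
    rewrite !(rmorphD, rmorphM, rmorphN) /=.
    transitivity (c k^-1 * c k * (c k^-1 * c k) * (c x + f) -
       c k^-1 * (c k^-1 * c k)); last by ring.
    by rewrite kk; ring.
  apply: (po_scale pP); first by rewrite mulr_ge0 // invr_ge0 ltW.
  apply: (po_add pP); last by apply: (po_add pP) => //; exact: po_mul.
  apply: (po_add pP); first by apply: (po_mul pP) => //; exact: po_mul.
  by apply: (po_scale pP) => //; exact: po_mul.
have up x y : x <= y -> P (c x + f) -> P (c y + f).
  move=> xy Px; rewrite -(subrK x y) rmorphD /= -addrA.
  by apply: (po_add pP) => //; apply: (po_cst pP); rewrite subr_ge0.
(* The bound is truncated at 0 because [step] requires a nonnegative [x]. *)
have iter n : P (c (Num.max 0 (`|r| - k^-1 *+ n)) + f).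
  elim: n => [|n IH].
    by rewrite mulr0n subr0; apply: up Prf; rewrite le_max ler_norm orbT.
  have [le0|gt0] := leP (`|r| - k^-1 *+ n) 0.
    move: IH; rewrite max_l // => IH.
    rewrite max_l // mulrSr opprD addrA -(addr0 0) lerD // oppr_le0.
    by rewrite invr_ge0 ltW.
  move: IH; rewrite max_r ?ltW // => /(step _ (ltW gt0)).
  by rewrite -addrA -opprD -mulrSr; apply: up; rewrite le_max lexx orbT.
have [n nr] : exists n, `|r| <= k^-1 *+ n.
  exists (Num.truncn (`|r| * k)).+1.
  rewrite -[leRHS]mulr_natr mulrC -ler_pdivrMr ?invr_gt0 //.
  by rewrite invrK ltW // truncnS_gt.
by have := iter n; rewrite max_l ?rmorph0 ?add0r // subr_le0.
Qed.

End Preorderings.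

(** * Characters from maximal preorderings *)

Section OrderedCharacter.
Context {R : realType} {A : comPzRingType} (c : {rmorphism R -> A}).
Implicit Types (Q : set A) (a b : A) (r s t e : R).

(** The elements infinitely close to the constant [t] for the partial order
    with positive cone [Q]; the value at [a] of the character attached to [Q]
    is the [t] with [pinned Q a t]. *)
Definition pinned Q a t :=
  forall e, 0 < e -> Q (a - c (t - e)) /\ Q (c (t + e) - a).

Variable Q : set A.
Hypotheses (pQ : preordering c Q) (QN1 : ~ Q (-1)).

Let cE := (rmorphD c, rmorphB c, rmorphM c, rmorphN c).

Lemma proper_cst r : Q (c r) -> 0 <= r.
Proof.
move=> Qr; rewrite leNgt; apply/negP => r0; apply: QN1.
have -> : -1 = c (- r^-1) * c r.
  by rewrite -rmorphM mulNr mulVf ?lt_eqF // cE rmorph1.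
by apply: (po_scale pQ) => //; rewrite oppr_ge0 invr_le0 ltW.
Qed.

Lemma pinned_le a b s t : pinned Q a s -> pinned Q b t -> Q (b - a) -> s <= t.
Proof.
move=> ps pt Qba; apply/ler_addgt0Pr => e e0.
have e2 : 0 < e / 2 by rewrite divr_gt0.
have [Qa _] := ps _ e2; have [_ Qb] := pt _ e2.
have : Q (c (t + e - s)).
  have -> : c (t + e - s) = (b - a) + (a - c (s - e / 2)) + (c (t + e / 2) - b).
    by rewrite [in LHS](splitr e) !cE; ring.
  by apply: (po_add pQ) => //; exact: (po_add pQ).
by move/proper_cst; rewrite subr_ge0.
Qed.

Lemma pinned_uniq a s t : pinned Q a s -> pinned Q a t -> s = t.
Proof.
have Q0 : Q (a - a) by rewrite subrr; exact: po0 pQ.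
by move=> ps pt; apply/le_anti; rewrite (pinned_le ps pt) ?(pinned_le pt ps).
Qed.

Lemma pinned_cst r : pinned Q (c r) r.
Proof.
move=> e e0; rewrite -!rmorphB; split; apply: (po_cst pQ); lra.
Qed.

Lemma pinnedD a b s t : pinned Q a s -> pinned Q b t -> pinned Q (a + b) (s + t).
Proof.
move=> ps pt e e0; have e2 : 0 < e / 2 by rewrite divr_gt0.
have [Qa Qa'] := ps _ e2; have [Qb Qb'] := pt _ e2.
split.
  have -> : a + b - c (s + t - e) = (a - c (s - e / 2)) + (b - c (t - e / 2)).
    by rewrite [in LHS](splitr e) !cE; ring.
  exact: (po_add pQ).
have -> : c (s + t + e) - (a + b) = (c (s + e / 2) - a) + (c (t + e / 2) - b).
  by rewrite [in LHS](splitr e) !cE; ring.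
exact: (po_add pQ).
Qed.

Lemma pinnedN a t : pinned Q a t -> pinned Q (- a) (- t).
Proof.
move=> pt e e0; have [Qa Qa'] := pt e e0; split.
  by have -> : - a - c (- t - e) = c (t + e) - a by rewrite !cE; ring.
by have -> : c (- t + e) - - a = a - c (t - e) by rewrite !cE; ring.
Qed.

Lemma pinnedZ r a t : pinned Q a t -> pinned Q (c r * a) (r * t).
Proof.
wlog r0 : r / 0 < r => [pos|] pt.
  have [r0|r0|<-] := ltgtP 0 r; first exact: pos.
    have -> : c r * a = - (c (- r) * a) by rewrite rmorphN; ring.
    have -> : r * t = - (- r * t) by ring.
    by apply: pinnedN; apply: pos pt; rewrite oppr_gt0.
  by rewrite rmorph0 !mul0r -(rmorph0 c); exact: pinned_cst.
move=> e e0; have [Qa Qa'] := pt (e / r) (divr_gt0 e0 r0).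
have ce : c e = c r * c (e / r) by rewrite -rmorphM mulrC divfK ?gt_eqF.
split.
  have -> : c r * a - c (r * t - e) = c r * (a - c (t - e / r)).
    by rewrite !(rmorphB, rmorphM c r t) ce; ring.
  exact: po_scale (ltW _) _.
have -> : c (r * t + e) - c r * a = c r * (c (t + e / r) - a).
  by rewrite !(rmorphD, rmorphM c r t) ce; ring.
exact: po_scale (ltW _) _.
Qed.

(** [2 (d ^ 2 + a b)] and [2 (d ^ 2 - a b)] are sums of two products of the
    nonnegative elements [d + a], [d - a], [d + b], [d - b]. *)
Lemma pinnedM00 a b : pinned Q a 0 -> pinned Q b 0 -> pinned Q (a * b) 0.
Proof.
move=> pa pb e e0; pose d := Num.sqrt e.
have d0 : 0 < d by rewrite sqrtr_gt0.
have cd : c e = c d * c d by rewrite -rmorphM -expr2 sqr_sqrtr // ltW.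
have [Qa Qa'] := pa _ d0; have [Qb Qb'] := pb _ d0.
have half x : Q (x + x) -> Q x.
  move=> Qx; have -> : x = c 2^-1 * (x + x).
    have -> : x + x = c 2 * x by rewrite rmorph_nat; ring.
    by rewrite mulrA -(rmorphM c) mulVf ?rmorph1 ?mul1r // pnatr_eq0.
  by apply: (po_scale pQ) => //; rewrite invr_ge0 ler0n.
rewrite sub0r add0r rmorphN opprK cd; split; apply: half.
  have -> : a * b + c d * c d + (a * b + c d * c d) =
      (a - c (0 - d)) * (b - c (0 - d)) + (c (0 + d) - a) * (c (0 + d) - b).
    by rewrite !cE rmorph0; ring.
  by apply: (po_add pQ); exact: (po_mul pQ).
have -> : c d * c d - a * b + (c d * c d - a * b) =
    (a - c (0 - d)) * (c (0 + d) - b) + (c (0 + d) - a) * (b - c (0 - d)).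
  by rewrite !cE rmorph0; ring.
by apply: (po_add pQ); exact: (po_mul pQ).
Qed.

Lemma pinnedM a b s t : pinned Q a s -> pinned Q b t -> pinned Q (a * b) (s * t).
Proof.
move=> ps pt.
have -> : a * b = (a - c s) * (b - c t) + (c s * b + (c t * a + - c (s * t))).
  by rewrite !cE; ring.
have E : s * t = 0 + (s * t + (t * s - s * t)) by ring.
rewrite [X in pinned _ _ X]E.
apply: pinnedD; last first.
  apply: pinnedD; first exact: pinnedZ.
  by apply: pinnedD; [exact: pinnedZ|apply: pinnedN; exact: pinned_cst].
have centre x r : pinned Q x r -> pinned Q (x - c r) 0.
  by move=> px; rewrite -(subrr r); apply/(pinnedD px)/pinnedN/pinned_cst.
by apply: pinnedM00; exact: centre.
Qed.

Lemma pinned_ge0 a t : Q a -> pinned Q a t -> 0 <= t.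
Proof.
move=> Qa pt; apply: (@pinned_le (c 0) a) => //; first exact: pinned_cst.
by rewrite rmorph0 subr0.
Qed.

Lemma pinned_ex a : (exists r, Q (c r + a)) -> (exists r, Q (c r - a)) ->
  (forall t, Q (c t - a) \/ Q (a - c t)) -> exists t, pinned Q a t.
Proof.
move=> [l Ql] [u Qu] tot; pose S := [set r | Q (a - c r)].
have Su : ubound S u.
  move=> r Sr; rewrite -subr_ge0; apply: proper_cst.
  have -> : c (u - r) = (c u - a) + (a - c r) by rewrite !cE; ring.
  exact: (po_add pQ).
have supS : has_sup S.
  by split; [exists (- l); rewrite /S /= rmorphN opprK addrC|exists u].
exists (sup S) => e e0; split.
  have [s Ss es] := sup_adherent e0 supS.
  have -> : a - c (sup S - e) = (a - c s) + c (s - (sup S - e)).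
    by rewrite !cE; ring.
  by apply: (po_add pQ) => //; apply: (po_cst pQ); rewrite subr_ge0 ltW.
have [//|/(ub_le_sup supS.2)] := tot (sup S + e).
by rewrite gerDl leNgt e0.
Qed.

End OrderedCharacter.

Section Representation.
Context {R : realType} {A : comPzRingType} (c : {rmorphism R -> A}).
Variables (H P : set A).
Hypothesis Hcst : forall r, H (c r).
Hypothesis Hsub : forall a b, H a -> H b -> H (a - b).
Hypotheses (pP : preordering c P) (PH : P `<=` H).
Hypothesis Psqr : forall a, H a -> P (a * a).
Hypothesis Parch : forall a, H a -> exists r, P (c r + a).

(** A version of the Kadison-Dubois representation theorem.  [invertible_pos]
    says that [- f] can be adjoined to [P] without reaching [-1]; a maximal
    preordering containing the result is total on [H], hence pins every element
    of [H] to a real number.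

    [H] stands for the self-adjoint elements, the only ones that [P] can order,
    so [tau] carries no information outside [H]. *)
Lemma character_of_preordering f : H f -> ~ P f ->
  exists tau : A -> R,
  [/\ forall a, P a -> 0 <= tau a, tau f <= 0, forall r, tau (c r) = r,
      forall a b, H a -> H b -> tau (a + b) = tau a + tau b
    & forall a b, H a -> H b -> tau (a * b) = tau a * tau b].
Proof.
move=> Hf nPf.
have HN a : H a -> H (- a).
  by move=> Ha; rewrite -sub0r -(rmorph0 c); exact: Hsub.
have pPf : preordering c (adjoin P (- f)).
  by apply: adjoin_preordering => //; rewrite mulrNN; exact: Psqr.
have [|Q [pQ QN1 PfQ Qmax]] := maximal_preordering pPf.
  move=> [s [p [Ps Pp E]]]; apply: nPf.
  have [k0 Pkf] := Parch Hf; have [k Pk] := Parch (HN _ (PH Pp)).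
  apply: (@invertible_pos R A c P p f (Num.max 1 k) k0) => //.
  - have -> : c (Num.max 1 k) - p = (c k - p) + c (Num.max 1 k - k).
      by rewrite rmorphB; ring.
    apply: (po_add pP) => //; apply: (po_cst pP).
    by rewrite subr_ge0 le_max lexx orbT.
  - by rewrite lt_max ltr01.
  - have -> : f * p - 1 = s; last by [].
    by rewrite E; ring.
have PQ a : P a -> Q a by move=> Pa; apply: PfQ; exact: (sub_adjoin (c := c)).
have tot b : H b -> Q b \/ Q (- b).
  by move=> Hb; apply: (maximal_total pQ QN1 Qmax); apply: PQ; exact: Psqr.
have ex a : H a -> exists t, pinned c Q a t.
  move=> Ha; apply: pinned_ex => //.
  - by have [r Pr] := Parch Ha; exists r; exact: PQ.
  - by have [r Pr] := Parch (HN _ Ha); exists r; exact: PQ.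
  - by move=> t; rewrite -[a - c t]opprB; apply: tot; exact: Hsub.
have HD a b : H a -> H b -> H (a + b).
  by move=> Ha Hb; rewrite -[b]opprK; apply: Hsub => //; exact: HN.
have [tau tauP] : {tau : A -> R | forall a, (exists t, pinned c Q a t) ->
    pinned c Q a (tau a)}.
  exists (fun a => get [set t | pinned c Q a t]) => a [t pt].
  exact: (@getI _ [set t | pinned c Q a t] t).
have tauE a t : pinned c Q a t -> tau a = t.
  by move=> pt; apply: (pinned_uniq pQ QN1 _ pt); apply: tauP; exists t.
exists tau; split=> [a Pa||r|a b Ha Hb|a b Ha Hb].
- by apply: (pinned_ge0 pQ QN1 (PQ _ Pa)); apply: tauP; apply: ex; exact: PH.
- have pf := tauP _ (ex _ Hf); rewrite -oppr_ge0.
  apply: (pinned_ge0 pQ QN1 _ (pinnedN pf)).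
  by apply: PfQ; exact: (mem_adjoin _ pP).
- by apply: tauE; exact: pinned_cst.
- by apply: tauE; apply: pinnedD => //; apply: tauP; exact: ex.
- by apply: tauE; apply: pinnedM => //; apply: tauP; exact: ex.
Qed.

End Representation.

(** * Positive elements and states of operator systems *)

Section OperatorSystemStates.
Context {R : realType}.
Implicit Types S T : opsystem R.

Definition hpos S (a : S) : Prop := mpos (const_mx a : 'M[S]_1).

Lemma mx11_const (V : Type) (A : 'M[V]_1) : A = const_mx (A ord0 ord0).
Proof. by apply/matrixP => i j; rewrite !mxE !ord1. Qed.

Lemma conjC_real (r : R) : (r%:C)^* = r%:C :> R[i].
Proof. by apply/CrealP; rewrite complex_real. Qed.

Lemma conjC_i : ('i%C : R[i])^* = - 'i%C.
Proof. by rewrite complexiE conjCi. Qed.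

Lemma mulii : ('i%C : R[i]) * 'i%C = -1.
Proof. by rewrite -expr2 sqr_i. Qed.

Lemma hpos_herm S (a : S) : hpos a -> star a = a.
Proof. by move=> /mpos_herm /(_ ord0 ord0); rewrite !mxE. Qed.

Lemma hposD S (a b : S) : hpos a -> hpos b -> hpos (a + b).
Proof.
by move=> pa pb; have := mpos_add pa pb; rewrite [X in mpos X]mx11_const !mxE.
Qed.

(** Compressing by a column brings positivity of a matrix down to positivity of
    single elements; this is why positive functionals are completely positive. *)
Lemma mpos_quadratic S n (A : 'M[S]_n) (v : 'I_n -> R[i]) : mpos A ->
  hpos (\sum_k \sum_l ((v k)^* * v l) *: A k l).
Proof.
move=> /(mpos_compress (\col_k v k)); rewrite [X in mpos X]mx11_const !mxE.
rewrite /hpos; congr (mpos (const_mx _)).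
by do 2![apply: eq_bigr => ? _]; rewrite !mxE.
Qed.

Lemma hposZ S (r : R) (a : S) : 0 <= r -> hpos a -> hpos (r%:C *: a).
Proof.
move=> r0 /(mpos_quadratic (fun=> (Num.sqrt r)%:C)).
by rewrite !big_ord1 mxE conjC_real -rmorphM /= -expr2 sqr_sqrtr.
Qed.

Lemma star0 S : star (0 : S) = 0.
Proof. by rewrite -(scale0r (0 : S)) starZ rmorph0 !scale0r. Qed.

Lemma starN S (a : S) : star (- a) = - star a.
Proof. by rewrite -scaleN1r starZ rmorphN rmorph1 scaleN1r. Qed.

Lemma starZr S (r : R) (a : S) : star (r%:C *: a) = r%:C *: star a.
Proof. by rewrite starZ conjC_real. Qed.

Lemma starZi S (a : S) : star ('i%C *: a) = - ('i%C *: star a).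
Proof. by rewrite starZ conjC_i scaleNr. Qed.

Lemma diag_unit1 S (r : R) (a : S) :
  diag_unit (r%:C *: ounit S) 1 + const_mx a = const_mx (r%:C *: ounit S + a).
Proof. by rewrite [LHS]mx11_const !mxE mulr1n. Qed.

Lemma hpos_archi S (a : S) : star a = a ->
  (forall r : R, 0 < r -> hpos (r%:C *: ounit S + a)) -> hpos a.
Proof.
move=> ha pa; apply: mpos_archi => [i j|r r0]; first by rewrite !mxE.
by rewrite diag_unit1; exact: pa.
Qed.

Lemma hpos_order_unit S (a : S) : star a = a ->
  exists2 r : R, 0 < r & hpos (r%:C *: ounit S + a).
Proof.
move=> ha; have [|r r0] := @mpos_unit R S 1 (const_mx a).
  by move=> i j; rewrite !mxE.
by rewrite diag_unit1; exists r.
Qed.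

Lemma hpos_unit S : hpos (ounit S).
Proof.
have [r r0] := hpos_order_unit (star0 S); rewrite addr0.
move=> /(@hposZ _ r^-1); rewrite scalerA -rmorphM mulVf ?gt_eqF // scale1r.
by apply; rewrite invr_ge0 ltW.
Qed.

Lemma hpos_proper S (a : S) : hpos a -> hpos (- a) -> a = 0.
Proof.
move=> pa na; have /matrixP/(_ ord0 ord0) : (const_mx a : 'M[S]_1) = 0.
  by apply: mpos_proper => //; rewrite [X in mpos X]mx11_const !mxE.
by rewrite !mxE.
Qed.

Lemma ucp_hpos S T (f : S -> T) a : ucp f -> hpos a -> hpos (f a).
Proof.
by move=> uf /(ucp_pos uf); rewrite [X in mpos X]mx11_const !mxE.
Qed.

Definition re_part S (a : S) : S := (2^-1)%:C *: (a + star a).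
Definition im_part S (a : S) : S := re_part (- ('i%C *: a)).

Lemma re_part_herm S (a : S) : star (re_part a) = re_part a.
Proof. by rewrite /re_part starZr starD starK addrC. Qed.

Lemma half_double S (a : S) : (2^-1)%:C *: (a + a) = a.
Proof.
by rewrite -mulr2n -[a *+ 2]scaler_nat scalerA -(rmorph_nat (real_complex R)) -rmorphM
  mulVf ?pnatr_eq0 // scale1r.
Qed.

Lemma re_part_id S (a : S) : star a = a -> re_part a = a.
Proof. by move=> ha; rewrite /re_part ha half_double. Qed.

Lemma re_partD S (a b : S) : re_part (a + b) = re_part a + re_part b.
Proof. by rewrite /re_part starD addrACA scalerDr. Qed.

Lemma re_partZ S (r : R) (a : S) : re_part (r%:C *: a) = r%:C *: re_part a.
Proof. by rewrite /re_part starZr -scalerDr !scalerA mulrC. Qed.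

Lemma re_partN S (a : S) : re_part (- a) = - re_part a.
Proof. by rewrite /re_part starN -opprD scalerN. Qed.

Lemma re_part_star S (a : S) : re_part (star a) = re_part a.
Proof. by rewrite /re_part starK addrC. Qed.

Lemma re_part_i S (a : S) : star a = a -> re_part ('i%C *: a) = 0.
Proof. by move=> ha; rewrite /re_part starZi ha subrr scaler0. Qed.

Lemma scaleii S (a : S) : 'i%C *: ('i%C *: a) = - a.
Proof. by rewrite scalerA mulii scaleN1r. Qed.

Lemma im_partE S (a : S) :
  im_part a = (2^-1)%:C *: ('i%C *: (star a - a)).
Proof.
by rewrite /im_part /re_part starN starZi opprK scalerBr [RHS]scalerBr scalerDr
  scalerN addrC -scalerBr.
Qed.

Lemma re_im_decomp S (a : S) : a = re_part a + 'i%C *: im_part a.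
Proof.
rewrite im_partE /re_part scalerA [_ * (2^-1)%:C]mulrC -scalerA scaleii -scalerDr.
by rewrite opprB addrACA subrr addr0 half_double.
Qed.

Lemma re_part_sum S (a b : S) : star a = a -> star b = b ->
  re_part (a + 'i%C *: b) = a.
Proof. by move=> ha hb; rewrite re_partD re_part_id // re_part_i // addr0. Qed.

Lemma im_part_sum S (a b : S) : star a = a -> star b = b ->
  im_part (a + 'i%C *: b) = b.
Proof.
move=> ha hb; rewrite /im_part scalerDr scaleii opprB addrC re_partD.
by rewrite re_partN re_part_i // oppr0 add0r re_part_id.
Qed.

Lemma ucpD S T (f : S -> T) : ucp f -> {morph f : a b / a + b}.
Proof.
by move=> uf a b; have := ucp_linear uf 1 a b; rewrite !scale1r.
Qed.

Lemma ucp0 S T (f : S -> T) : ucp f -> f 0 = 0.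
Proof. by move=> uf; apply: (addrI (f 0)); rewrite -ucpD // !addr0. Qed.

Lemma ucpZ S T (f : S -> T) z a : ucp f -> f (z *: a) = z *: f a.
Proof.
by move=> uf; have := ucp_linear uf z a 0; rewrite !addr0 (ucp0 uf) addr0.
Qed.

Lemma ucpN S T (f : S -> T) a : ucp f -> f (- a) = - f a.
Proof. by move=> uf; rewrite -scaleN1r ucpZ // scaleN1r. Qed.

(** A self-adjoint element is a difference of a positive one and a multiple of
    the unit, so its image is self-adjoint. *)
Lemma ucp_star S T (f : S -> T) a : ucp f -> f (star a) = star (f a).
Proof.
move=> uf; have fh b : star b = b -> star (f b) = f b.
  move=> hb; have [r _] := hpos_order_unit hb.
  move=> /(ucp_hpos uf)/hpos_herm; rewrite (ucpD uf) (ucpZ _ _ uf) (ucp_unit uf).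
  by rewrite starD starZr star_unit => /addrI.
have key b d : star b = b -> star d = d ->
    f (star (b + 'i%C *: d)) = star (f (b + 'i%C *: d)).
  move=> hb hd; rewrite starD starZi hb hd !(ucpD uf) (ucpN _ uf) !(ucpZ _ _ uf).
  by rewrite starD starZi !fh.
by rewrite (re_im_decomp a); apply: key; exact: re_part_herm.
Qed.

(** States are represented by their real parts: averaging over a group and
    evaluation of a preordering produce real numbers, and [complexify] recovers
    the complex functional. *)
Record real_state S (tau : S -> R) : Prop := {
  rs_add : {morph tau : a b / a + b};
  rs_scale : forall (r : R) a, tau (r%:C *: a) = r * tau a;
  rs_star : forall a, tau (star a) = tau a;
  rs_unit : tau (ounit S) = 1;
  rs_ge0 : forall a, hpos a -> 0 <= tau a }.

Lemma rs0 S (tau : S -> R) : real_state tau -> tau 0 = 0.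
Proof. by move=> st; rewrite -(scale0r (0 : S)) (rs_scale st 0) mul0r. Qed.

Lemma rsN S (tau : S -> R) a : real_state tau -> tau (- a) = - tau a.
Proof.
by move=> st; rewrite -scaleN1r -(rmorphN1 (real_complex R)) rs_scale // mulN1r.
Qed.

Lemma rs_re S (tau : S -> R) a : real_state tau -> tau (re_part a) = tau a.
Proof.
move=> st; rewrite /re_part rs_scale // rs_add // rs_star //; lra.
Qed.

Lemma rs_comp S T (f : S -> T) tau :
  real_state tau -> ucp f -> real_state (tau \o f).
Proof.
move=> st uf; split=> [a b|r a|a||a pa] /=.
- by rewrite ucpD // rs_add.
- by rewrite ucpZ // rs_scale.
- by rewrite ucp_star // rs_star.
- by rewrite ucp_unit // rs_unit.
- exact/rs_ge0/ucp_hpos.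
Qed.

(** The bound does not depend on the state; this makes the functions
    [g |-> tau (g^-1 a)] bounded on [G]. *)
Lemma rs_bound S (a : S) :
  exists r : R, forall tau, real_state tau -> `|tau a| <= r.
Proof.
have [r r0 pr] := hpos_order_unit (re_part_herm a).
have [|s s0 ps] := @hpos_order_unit S (- re_part a).
  by rewrite starN re_part_herm.
exists (r + s) => tau st; have := rs_ge0 st pr; have := rs_ge0 st ps.
rewrite !(rs_add st) (rsN _ st) (rs_re _ st) !(rs_scale st) (rs_unit st).
by rewrite ler_norml => *; lra.
Qed.

(** The complex-linear functional with real part [tau]. *)
Definition complexify S (tau : S -> R) (a : S) : R[i] :=
  (tau a -i* tau ('i%C *: a))%C.

Lemma complexify_linear S (tau : S -> R) :
  real_state tau -> linear (complexify tau : S -> R[i]^o).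
Proof.
move=> st z a b.
have tZ (w : R[i]) c :
    tau (w *: c) = complex.Re w * tau c + complex.Im w * tau ('i%C *: c).
  rewrite [in LHS](complexE w) ['i%C * _]mulrC scalerDl -scalerA.
  by rewrite (rs_add st) !(rs_scale st).
have im : tau ('i%C *: (z *: a + b)) =
    complex.Re z * tau ('i%C *: a) - complex.Im z * tau a + tau ('i%C *: b).
  by rewrite scalerDr (rs_add st) scalerA ['i%C * z]mulrC -scalerA tZ scaleii
    (rsN _ st) mulrN.
have {tZ} re := tZ z a.
change (complexify tau (z *: a + b) = z * complexify tau a + complexify tau b).
rewrite /complexify im (rs_add st) re; case: z {re im} => x y /=.
by apply/eqP; rewrite eq_complex /=; apply/andP; split; apply/eqP; ring.
Qed.

Lemma complexify_herm S (tau : S -> R) a :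
  real_state tau -> star a = a -> complexify tau a = (tau a)%:C.
Proof.
move=> st ha; rewrite /complexify -(rs_re ('i%C *: a) st) re_part_i //.
by rewrite rs0 // oppr0.
Qed.

Lemma complexify0 S (tau : S -> R) : real_state tau -> complexify tau 0 = 0.
Proof. by move=> st; rewrite complexify_herm ?star0 // rs0. Qed.

Lemma complexifyD S (tau : S -> R) :
  real_state tau -> {morph complexify tau : a b / a + b}.
Proof.
by move=> st a b; have := complexify_linear st 1 a b; rewrite !scale1r.
Qed.

Lemma complexifyZ S (tau : S -> R) z a :
  real_state tau -> complexify tau (z *: a) = z * complexify tau a.
Proof.
move=> st; have := complexify_linear st z a 0.
by rewrite !addr0 complexify0 // addr0.
Qed.

Lemma complexify_star S (tau : S -> R) a :
  real_state tau -> complexify tau (star a) = (complexify tau a)^*.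
Proof.
move=> st; rewrite /complexify rs_star // -[in LHS](rs_star st ('i%C *: _)).
by rewrite starZi starK rsN.
Qed.

Lemma complexify_unit S (tau : S -> R) :
  real_state tau -> complexify tau (ounit S) = 1.
Proof. by move=> st; rewrite complexify_herm ?star_unit ?rs_unit. Qed.

Lemma complexify_quadratic S (tau : S -> R) n (A : 'M[S]_n) v :
  real_state tau ->
  complexify tau (\sum_k \sum_l ((v k)^* * v l) *: A k l) =
  qform (map_mx (complexify tau) A) v.
Proof.
move=> st.
rewrite (big_morph _ (complexifyD st) (complexify0 st)); apply: eq_bigr => k _.
rewrite (big_morph _ (complexifyD st) (complexify0 st)); apply: eq_bigr => l _.
by rewrite complexifyZ // mxE mulrAC.
Qed.

Lemma complexify_psd S (tau : S -> R) n (A : 'M[S]_n) :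
  real_state tau -> mpos A -> psdmx (map_mx (complexify tau) A).
Proof.
move=> st pA; split=> [i j|v].
  by rewrite !mxE [in LHS](mpos_herm pA) complexify_star.
rewrite -complexify_quadratic //.
have pv := mpos_quadratic v pA.
by rewrite complexify_herm ?lecR ?rs_ge0 //; exact: hpos_herm.
Qed.

Lemma norm_realC (r : R) : `|r%:C : R[i]| = `|r|%:C.
Proof. by rewrite normc_def /= expr0n addr0 sqrtr_sqr. Qed.

Lemma complexify_bound S (a : S) :
  exists r : R, forall tau, real_state tau -> `|complexify tau a| <= r%:C.
Proof.
have [r ra] := rs_bound a; have [s sa] := rs_bound ('i%C *: a).
exists (r + s) => tau st; rewrite /complexify.
have -> : (tau a -i* tau ('i%C *: a))%C = (tau a)%:C - 'i%C * (tau ('i%C *: a))%:C.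
  by apply/eqP; rewrite eq_complex /=; apply/andP; split; apply/eqP; ring.
have ni : `|'i%C : R[i]| = 1 by rewrite complexiE normCi.
apply: le_trans (ler_normB _ _) _; rewrite normrM ni mul1r rmorphD /=.
by rewrite !norm_realC lerD // lecR; [exact: ra|exact: sa].
Qed.

Lemma complexify_comp (S T : opsystem R) (f : S -> T) (tau : T -> R) a :
  ucp f -> complexify tau (f a) = complexify (tau \o f) a.
Proof. by move=> uf; rewrite /complexify /= ucpZ. Qed.

End OperatorSystemStates.

(** * Gelfand duality *)

Section GelfandDuality.
Context {G : groupType} {R : realType} {I : gopsystem G R}.
Variable cs : comm_gcstar I.
Implicit Types a b : I.

(** The carrier of [I] as a commutative ring; the product depends on [cs], so
    it cannot be attached to [I] itself. *)
Definition calg of comm_gcstar I : Type := I.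
HB.instance Definition _ := GRing.Zmodule.copy (calg cs) (gopsys_sort I).

Fact calg_mulDl : left_distributive (cmul cs) +%R.
Proof. by move=> a b d; exact: cmulDl. Qed.

HB.instance Definition _ := GRing.Zmodule_isComPzRing.Build (calg cs)
  (cmulA cs) (cmulC cs) (cmul1 cs) calg_mulDl.

Definition calg_const (r : R) : calg cs := r%:C *: ounit I.

Fact calg_const_additive : zmod_morphism calg_const.
Proof. by move=> r s; rewrite /calg_const rmorphB scalerBl. Qed.
Fact calg_const_multiplicative : monoid_morphism calg_const.
Proof.
split=> [|r s]; first by rewrite /calg_const rmorph1 scale1r.
rewrite /calg_const rmorphM -scalerA -[RHS]/(cmul cs _ _) (cmulZl cs).
by rewrite (cmul1 cs).
Qed.
HB.instance Definition _ := GRing.isZmodMorphism.Build R (calg cs) calg_const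
  calg_const_additive.
HB.instance Definition _ := GRing.isMonoidMorphism.Build R (calg cs) calg_const
  calg_const_multiplicative.

Lemma calg_scale (r : R) a : calg_const r * (a : calg cs) = r%:C *: a.
Proof.
by rewrite /calg_const -[LHS]/(cmul cs _ _) (cmulZl cs) (cmul1 cs).
Qed.

Lemma hpos_square a : hpos (cmul cs (star a) a).
Proof.
apply/(cstar_mpos cs); exists (const_mx a); apply/matrixP => i j.
by rewrite !mxE big_ord1 !mxE.
Qed.

Lemma hposE a : hpos a -> exists b, a = cmul cs (star b) b.
Proof.
move=> /(cstar_mpos cs)[B /matrixP/(_ ord0 ord0)]; rewrite !mxE big_ord1 => ->.
by exists (B ord0 ord0).
Qed.

(** Commutativity turns a product of two squares into a square. *)
Lemma hposM a b : hpos a -> hpos b -> hpos (cmul cs a b).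
Proof.
move=> /hposE[x ->] /hposE[y ->].
have -> : cmul cs (cmul cs (star x) x) (cmul cs (star y) y) =
    cmul cs (star (cmul cs x y)) (cmul cs x y).
  rewrite star_cmul.
  change ((star x : calg cs) * (x : calg cs) * ((star y : calg cs) * y) =
          (star y : calg cs) * star x * ((x : calg cs) * y)).
  ring.
exact: hpos_square.
Qed.

Lemma hpos_preordering : preordering calg_const (@hpos R I : set (calg cs)).
Proof.
split=> [a b|a b|r r0]; [exact: hposD|exact: hposM|].
by apply: hposZ => //; exact: hpos_unit.
Qed.

(** The character of the self-adjoint part given by [character_of_preordering]
    extends to [I] by composition with [re_part]; the complex functional is
    multiplicative because real and imaginary parts multiply like those of
    complex numbers. *)
Lemma multiplicative_state (f : I) : star f = f -> ~ hpos f ->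
  exists2 tau : I -> R, real_state tau & tau f <= 0 /\
    spectrum cs (complexify tau).
Proof.
move=> hf nf.
have hB a b : star a = a -> star b = b -> star (a - b) = a - b.
  by move=> ha hb; rewrite starD starN ha hb.
have [|||||t [t0 tf tc tD tM]] := @character_of_preordering R (calg cs) calg_const
  [set a | star a = a] (@hpos R I) _ _ hpos_preordering _ _ _ f hf nf.
- by move=> r /=; rewrite starZr star_unit.
- exact: hB.
- exact: hpos_herm.
- by move=> a /= ha; have := hpos_square a; rewrite ha.
- by move=> a /hpos_order_unit[r _ pr]; exists r.
pose tau a := t (re_part a).
have tZ r a : star a = a -> t (r%:C *: a) = r * t a.
  move=> ha; rewrite -calg_scale tM //= ?tc //.
  by rewrite starZr star_unit.
have tN a : star a = a -> t (- a) = - t a.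
  move=> ha; rewrite -scaleN1r -(rmorphN1 (real_complex R)) tZ //.
  by rewrite mulN1r.
have st : real_state tau.
  split=> [a b|r a|a||a pa]; rewrite /tau.
  - by rewrite re_partD tD //; exact: re_part_herm.
  - by rewrite re_partZ tZ //; exact: re_part_herm.
  - by rewrite re_part_star.
  - by rewrite re_part_id ?star_unit // -[ounit I]scale1r -(rmorph1 (real_complex R)) (tc 1).
  - by rewrite re_part_id; [exact: t0|exact: hpos_herm].
exists tau => //; split; first by rewrite /tau re_part_id.
split=> [||a b]; [exact: complexify_linear|exact: complexify_unit|].
have cE x : complexify tau x = (t (re_part x) +i* t (im_part x))%C.
  rewrite /complexify /tau /im_part re_partN tN //.
  exact: re_part_herm.
have hM x y : star x = x -> star y = y -> star (cmul cs x y) = cmul cs x y.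
  by move=> hx hy; rewrite star_cmul hx hy (cmulC cs).
set x := re_part a; set y := im_part a; set z := re_part b; set w := im_part b.
have [hx hy hz hw] : [/\ star x = x, star y = y, star z = z & star w = w].
  by split; exact: re_part_herm.
have E : cmul cs a b = (cmul cs x z - cmul cs y w) +
    'i%C *: (cmul cs x w + cmul cs y z).
  pose j : calg cs := 'i%C *: ounit I.
  have jE (u : calg cs) : 'i%C *: (u : I) = j * u.
    by rewrite -[RHS]/(cmul cs _ _) (cmulZl cs) (cmul1 cs).
  have jj : j * j = -1 by rewrite -jE /j scaleii.
  rewrite [in LHS](re_im_decomp a) [in LHS](re_im_decomp b) -/x -/y -/z -/w.
  clearbody x y z w; rewrite !jE.
  change (((x : calg cs) + j * y) * (z + j * w) =
    (x : calg cs) * z - (y : calg cs) * w + j * ((x : calg cs) * w + (y : calg cs) * z)).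
  (* The sign of the product of imaginary parts comes from [j * j = -1]. *)
  rewrite -[- _]mulN1r -jj; ring.
have h1 : star (cmul cs x z - cmul cs y w) = cmul cs x z - cmul cs y w.
  by apply: hB; exact: hM.
have h2 : star (cmul cs x w + cmul cs y z) = cmul cs x w + cmul cs y z.
  by rewrite starD !hM.
have tB u v : star u = u -> star v = v -> t (u - v) = t u - t v.
  by move=> hu hv; rewrite tD ?tN //= starN hv.
rewrite !cE -/x -/y -/z -/w E re_part_sum ?im_part_sum //.
have tM' u v : star u = u -> star v = v -> t (cmul cs u v) = t u * t v.
  exact: tM.
rewrite tB ?hM // tD /= ?hM //.
by rewrite !tM'.
Qed.

Lemma hpos_of_spectrum (a : I) : star a = a ->
  (forall tau, real_state tau -> spectrum cs (complexify tau) -> 0 <= tau a) ->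
  hpos a.
Proof.
move=> ha pa; apply: hpos_archi => // r r0; apply: contrapT => na.
have [|tau st [tle spec]] := multiplicative_state _ na.
  by rewrite starD starZr star_unit ha.
move: tle; rewrite (rs_add st) (rs_scale st) (rs_unit st) mulr1 leNgt.
by rewrite ltr_wpDr // pa.
Qed.

(** An element killed by all characters has real and imaginary parts that are
    both nonnegative and nonpositive. *)
Lemma states_separate (a : I) :
  (forall tau, real_state tau -> spectrum cs (complexify tau) ->
    complexify tau a = 0) -> a = 0.
Proof.
move=> a0; have key b : star b = b -> (forall tau, real_state tau ->
    spectrum cs (complexify tau) -> tau b = 0) -> b = 0.
  move=> hb b0; apply: hpos_proper; apply: hpos_of_spectrum.
  - by [].
  - by move=> tau st sp; rewrite b0.
  - by rewrite starN hb.
  - by move=> tau st sp; rewrite (rsN _ st) b0 // oppr0.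
have z0 tau : real_state tau -> spectrum cs (complexify tau) ->
    tau a = 0 /\ tau ('i%C *: a) = 0.
  by move=> st /(a0 _ st)[-> /eqP]; rewrite oppr_eq0 => /eqP.
have ra : re_part a = 0.
  apply: key; first exact: re_part_herm.
  by move=> tau st /(z0 _ st)[ta _]; rewrite (rs_re _ st).
have ia : im_part a = 0.
  apply: key; first exact: re_part_herm.
  move=> tau st /(z0 _ st)[_ ta].
  by rewrite /im_part (rs_re _ st) (rsN _ st) ta oppr0.
by rewrite [LHS]re_im_decomp ra ia scaler0 addr0.
Qed.

(** [a] is not assumed self-adjoint: a real value at every state forces it. *)
Lemma hpos_of_states (a : I) :
  (forall tau, real_state tau -> 0 <= complexify tau a) -> hpos a.
Proof.
move=> pa; apply: hpos_of_spectrum => [|tau st _]; last first.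
  by have := pa _ st; rewrite lecE => /andP[].
apply: subr0_eq; apply: states_separate => tau st _.
rewrite complexifyD // -scaleN1r complexifyZ // mulN1r complexify_star //.
by apply/eqP; rewrite subr_eq0; apply/eqP/CrealP; rewrite ger0_real // pa.
Qed.

End GelfandDuality.

(** * Bounded functions as an operator system *)

Section BoundedFunctions.
Context {R : realType} {D : Type}.

Definition bfun_pred : {pred (D -> R[i]^o)} :=
  mem [set f : D -> R[i]^o | exists r : R, forall d, `|f d : R[i]| <= r%:C].

Lemma bfun_submod_closed : submod_closed bfun_pred.
Proof.
split=> [|c f g].
  by apply/mem_set; exists 0 => d; rewrite normr0.
move=> /set_mem[r fr] /set_mem[s gs]; apply/mem_set.
exists (complex.Re `|c| * r + s) => d.
apply: le_trans (ler_normD _ _) _.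
have cE : (complex.Re `|c|)%:C = `|c| by rewrite RRe_real // normr_real.
by rewrite rmorphD rmorphM /= cE lerD // normrM ler_wpM2l.
Qed.
HB.instance Definition _ :=
  GRing.isSubmodClosed.Build R[i] (D -> R[i]^o) bfun_pred bfun_submod_closed.

Record bfun := BFun { bfun_fun :> D -> R[i]^o; _ : bfun_fun \in bfun_pred }.
HB.instance Definition _ := [isSub for bfun_fun].
HB.instance Definition _ := [Choice of bfun by <:].
HB.instance Definition _ := [SubChoice_isSubLmodule of bfun by <:].
Implicit Types f g : bfun.

Lemma bfun_bounded f : exists r : R, forall d, `|f d : R[i]| <= r%:C.
Proof. by have := valP f; rewrite inE. Qed.

Lemma bfun_sum d (J : Type) (s : seq J) (P : pred J) (F : J -> bfun) :
  (\sum_(i <- s | P i) F i) d = \sum_(i <- s | P i) F i d.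
Proof. exact: (big_morph (fun f : bfun => f d)). Qed.

Definition bfun_star f : bfun.
Proof.
apply: (@BFun (fun d => (f d : R[i])^* : R[i]^o)).
rewrite inE /=; have [r fr] := bfun_bounded f.
by exists r => d; rewrite norm_conjC.
Defined.

Definition bfun_one : bfun.
Proof.
by apply: (@BFun (fun=> 1)); rewrite inE /=; exists 1 => d; rewrite normr1.
Defined.

Definition bfun_mpos n : set 'M[bfun]_n :=
  [set A | forall d, psdmx (map_mx (fun f => f d : R[i]) A)].

Fact bfun_starK f : bfun_star (bfun_star f) = f.
Proof. by apply/val_inj/funext => d /=; exact: conjCK. Qed.

Fact bfun_starD f g : bfun_star (f + g) = bfun_star f + bfun_star g.
Proof. by apply/val_inj/funext => d; exact: rmorphD. Qed.

Fact bfun_starZ (c : R[i]) f : bfun_star (c *: f) = c^* *: bfun_star f.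
Proof. by apply/val_inj/funext => d; exact: rmorphM. Qed.

Fact bfun_star_one : bfun_star bfun_one = bfun_one.
Proof. by apply/val_inj/funext => d; exact: rmorph1. Qed.

Fact bfun_mpos_herm n (A : 'M[bfun]_n) :
  bfun_mpos A -> hermitian_mx bfun_star A.
Proof.
move=> pA i j; apply/val_inj/funext => d.
by have [/(_ i j)] := pA d; rewrite !mxE.
Qed.

Lemma eval_mxD n (A B : 'M[bfun]_n) d :
  map_mx (fun f => f d : R[i]) (A + B) =
  map_mx (fun f => f d : R[i]) A + map_mx (fun f => f d : R[i]) B.
Proof. by apply/matrixP => i j; rewrite !mxE. Qed.

Lemma eval_mxN n (A : 'M[bfun]_n) d :
  map_mx (fun f => f d : R[i]) (- A) = - map_mx (fun f => f d : R[i]) A.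
Proof. by apply/matrixP => i j; rewrite !mxE. Qed.

Fact bfun_mpos_add n (A B : 'M[bfun]_n) :
  bfun_mpos A -> bfun_mpos B -> bfun_mpos (A + B).
Proof. by move=> pA pB d; rewrite eval_mxD; exact: psdmxD. Qed.

Fact bfun_mpos_compress m n (alpha : 'M[R[i]]_(m, n)) (A : 'M[bfun]_m) :
  bfun_mpos A -> bfun_mpos (compress alpha A).
Proof.
move=> pA d; have := psdmx_compress alpha (pA d).
congr psdmx; apply/matrixP => i j; rewrite !mxE bfun_sum.
apply: eq_bigr => k _; rewrite bfun_sum; apply: eq_bigr => l _.
by rewrite mxE.
Qed.

Fact bfun_mpos_proper n (A : 'M[bfun]_n) :
  bfun_mpos A -> bfun_mpos (- A) -> A = 0.
Proof.
move=> pA nA; apply/matrixP => i j; rewrite mxE; apply/val_inj/funext => d.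
have /matrixP/(_ i j) : map_mx (fun f => f d : R[i]) A = 0.
  by apply: psdmx_proper (pA d) _; have := nA d; rewrite eval_mxN.
by rewrite !mxE.
Qed.

Lemma bfun_diag_unit n (r : R) d :
  map_mx (fun f => f d : R[i]) (diag_unit (r%:C *: bfun_one) n) =
  \matrix_(i, j) (r%:C *+ (i == j)).
Proof.
apply/matrixP => i j; rewrite !mxE.
by case: (i == j); rewrite ?mulr1n ?mulr0n //=; exact: mulr1.
Qed.

Lemma bfun_shift_herm n (A : 'M[bfun]_n) (r : R) d : hermitian_mx bfun_star A ->
  forall i j, map_mx (fun f => f d : R[i]) (diag_unit (r%:C *: bfun_one) n + A) i j =
  (map_mx (fun f => f d : R[i]) (diag_unit (r%:C *: bfun_one) n + A) j i)^*.
Proof.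
move=> hA i j; rewrite eval_mxD bfun_diag_unit !mxE hA rmorphD rmorphMn /=.
by rewrite conjC_real eq_sym.
Qed.

Fact bfun_mpos_unit n (A : 'M[bfun]_n) : hermitian_mx bfun_star A ->
  exists2 r : R, 0 < r & bfun_mpos (diag_unit (r%:C *: bfun_one) n + A).
Proof.
move=> hA.
have /choice[b bP] : forall ij : 'I_n * 'I_n, exists r : R,
    forall d, `|A ij.1 ij.2 d : R[i]| <= r%:C.
  by move=> ij; exact: bfun_bounded.
pose M : R := \sum_ij `|b ij|.
have bM i j d : `|A i j d : R[i]| <= M%:C.
  apply: le_trans (bP (i, j) d) _; rewrite lecR.
  by rewrite /M (bigD1 (i, j)) //= ler_wpDr ?ler_norm // sumr_ge0.
have M0 : 0 <= M by rewrite sumr_ge0.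
exists (1 + M *+ (n + n)); first by rewrite ltr_pwDl // mulrn_wge0.
move=> d; split=> [|v]; first exact: bfun_shift_herm.
rewrite eval_mxD bfun_diag_unit qformD qform_scalar.
set Q := qform _ v; set s := \sum_i _.
have s0 : 0 <= s by apply: sumr_ge0 => i _; rewrite exprn_ge0.
have Qs : `|Q| <= M%:C *+ (n + n) * s.
  by apply: qform_norm => i j; rewrite mxE.
have Qr : Q \is Num.real by apply: qform_real => i j; rewrite !mxE hA.
rewrite rmorphD rmorphMn rmorph1 /= mulrDl mul1r -addrA addr_ge0 //.
by rewrite -lerBlDr sub0r (le_trans _ Qs) // -normrN real_ler_norm // rpredN.
Qed.

Fact bfun_mpos_archi n (A : 'M[bfun]_n) : hermitian_mx bfun_star A ->
  (forall r : R, 0 < r -> bfun_mpos (diag_unit (r%:C *: bfun_one) n + A)) ->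
  bfun_mpos A.
Proof.
move=> hA pA d; split=> [i j|v]; first by rewrite !mxE hA.
set Q := qform _ v.
have Qr : Q \is Num.real by apply: qform_real => i j; rewrite !mxE hA.
pose s := \sum_i `|v i| ^+ 2.
have s0 : 0 <= s by apply: sumr_ge0 => i _; rewrite exprn_ge0.
have sE : s = (complex.Re s)%:C by rewrite RRe_real // ger0_real.
have QE : Q = (complex.Re Q)%:C by rewrite RRe_real.
have s1 : 0 < complex.Re s + 1 by rewrite ltr_pwDr // -lecR -sE.
rewrite QE lecR; apply/ler_addgt0Pl => e e0.
have := (pA (e / (complex.Re s + 1)) (divr_gt0 e0 s1) d).2 v.
rewrite eval_mxD bfun_diag_unit qformD qform_scalar -/s -/Q sE QE.
rewrite -rmorphM -rmorphD lecR /= => /le_trans; apply.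
by rewrite lerD2r mulrAC ler_pdivrMr // ler_pM2l // lerDl.
Qed.

Definition bfun_opsystem : opsystem R :=
  OpSystem bfun_starK bfun_starD bfun_starZ bfun_star_one bfun_mpos_herm
    bfun_mpos_add bfun_mpos_compress bfun_mpos_proper bfun_mpos_unit
    bfun_mpos_archi.

End BoundedFunctions.
Arguments bfun R D : clear implicits.

Section TranslationSystem.
Context {R : realType} {G : groupType} {Z : Type}.

Definition bfun_translate (g : G) (f : bfun R (G * Z)) : bfun R (G * Z).
Proof.
apply: (@BFun _ _ (fun d => f (g^-1 * d.1, d.2)%g)).
by rewrite inE /=; have [r fr] := bfun_bounded f; exists r => d.
Defined.

Fact bfun_translate1 f : bfun_translate 1%g f = f.
Proof. by apply/val_inj/funext => -[g z] /=; rewrite invg1 mul1g. Qed.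

Fact bfun_translateM g h f :
  bfun_translate (g * h)%g f = bfun_translate g (bfun_translate h f).
Proof. by apply/val_inj/funext => d /=; rewrite invgM mulgA. Qed.

Fact bfun_translate_ucp g :
  ucp (bfun_translate g : @bfun_opsystem R (G * Z) -> @bfun_opsystem R (G * Z)).
Proof.
split=> [a f h||n A pA d]; [exact/val_inj|exact/val_inj|].
have := pA (g^-1 * d.1, d.2)%g.
by congr psdmx; apply/matrixP => i j; rewrite !mxE.
Qed.

Definition translation_gopsystem : gopsystem G R :=
  @GOpSystem G R bfun_opsystem bfun_translate bfun_translate1
    bfun_translateM bfun_translate_ucp.

End TranslationSystem.
Arguments translation_gopsystem R G Z : clear implicits.

(** * Amenability *)

Lemma action_kernel_normal (G : groupType) (T : Type) (act : G -> T -> T) :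
  (forall x, act 1%g x = x) ->
  (forall g h x, act (g * h)%g x = act g (act h x)) ->
  normal_subgroup (action_kernel act [set: T]).
Proof.
move=> act1 actM; split=> [x _|g h kg kh x _|g kg x _|g h kh x _].
- exact: act1.
- by rewrite actM kh ?kg.
- by rewrite -[in LHS](kg x I) -actM mulVg act1.
- by rewrite !actM kh // -actM mulgV act1.
Qed.

Lemma normal_subgroupI (G : groupType) (N M : set G) :
  normal_subgroup N -> normal_subgroup M -> normal_subgroup (N `&` M).
Proof.
move=> nN nM; split=> [|g h [Ng Mg] [Nh Mh]|g [Ng Mg]|g h [Nh Mh]].
- by split; exact: nsg1.
- by split; exact: nsgM.
- by split; exact: nsgV.
- by split; exact: nsgJ.
Qed.

Section RelativeAmenability.
Context {R : realType} {G : groupType}.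
Implicit Types (N M : set G) (m : (G -> R) -> R).

(** A mean on [M] that is invariant only under the smaller set [N].  It covers
    both the restriction of an [M]-invariant mean and means on all of [G]. *)
Record relative_mean N M m : Prop := {
  rm_add : forall f f', bounded_on M f -> bounded_on M f' ->
    m (fun x => f x + f' x) = m f + m f';
  rm_scale : forall c f, bounded_on M f -> m (fun x => c * f x) = c * m f;
  rm_ge0 : forall f, bounded_on M f -> (forall h, M h -> 0 <= f h) -> 0 <= m f;
  rm_one : m (fun=> 1) = 1;
  rm_inv : forall h f, N h -> bounded_on M f -> m (fun x => f (h * x)%g) = m f }.

(** [s g] is the [N]-component of [g] with respect to a chosen representative
    of the coset [N g]. *)
Lemma equivariant_retraction N : normal_subgroup N ->
  exists s : G -> G, (forall g, N (s g)) /\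
    forall h g, N h -> s (h * g)%g = (h * s g)%g.
Proof.
move=> nN; pose coset g := [set h | N (h * g^-1)%g].
pose rep g := xget 1%g (coset g).
have repP g : N (rep g * g^-1)%g.
  by apply: (@xgetPex _ _ (coset g)); exists g; rewrite /coset /= mulgV; exact: nsg1.
have repE h g : N h -> rep (h * g)%g = rep g.
  move=> Nh; rewrite /rep; congr xget; apply/seteqP; split=> x /=.
    move=> Nx; have := nsgM nN Nx Nh.
    by rewrite invgM -!mulgA mulVg mulg1.
  by move=> Nx; rewrite /coset /= invgM mulgA; apply: (nsgM nN) => //; exact: nsgV.
exists (fun g => g * (rep g)^-1)%g; split=> [g|h g Nh].
  by rewrite -[X in N X]invgK invgM invgK; apply: nsgV => //; exact: repP.
by rewrite repE // mulgA.
Qed.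

(** Functions on [N] are pulled back to [M] along the equivariant retraction, so
    amenability passes to subgroups. *)
Lemma amenable_of_relative_mean N M m :
  normal_subgroup N -> N `<=` M -> relative_mean N M m -> amenable R N.
Proof.
move=> nN NM rm; have [s [sN sM]] := equivariant_retraction nN.
have bs f : bounded_on N f -> bounded_on M (f \o s).
  by move=> [r fr]; exists r => h _; exact: fr.
exists (fun f => m (f \o s)); split.
- by move=> f f' /bs bf /bs bf'; exact: (rm_add rm).
- by move=> c f /bs bf; exact: (rm_scale rm).
- by move=> f /bs bf f0; apply: (rm_ge0 rm) => // h _; exact: f0.
- exact: (rm_one rm).
- move=> h f Nh /bs bf; rewrite -(rm_inv rm Nh bf); congr m.
  by apply/funext => g /=; rewrite sM.
Qed.

Lemma mean_eq_on M m f f' : invariant_mean M m ->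
  bounded_on M f -> (forall h, M h -> f h = f' h) -> m f = m f'.
Proof.
move=> mm [r fr] ff'.
have bf : bounded_on M f by exists r.
have bf' : bounded_on M f' by exists r => h Mh; rewrite -ff' //; exact: fr.
have bN (u : G -> R) : bounded_on M u -> bounded_on M (fun x => -1 * u x).
  by move=> [q uq]; exists q => h Mh; rewrite mulN1r normrN; exact: uq.
have le u v : bounded_on M u -> bounded_on M v -> (forall h, M h -> u h = v h) ->
    m u <= m v.
  move=> bu bv uv; rewrite -subr_ge0 -mulN1r -(im_scale mm) //.
  rewrite -(im_add mm) //; last exact: bN.
  apply: (im_ge0 mm) => [|h Mh]; last by rewrite uv // mulN1r subrr.
  by exists 0 => h Mh; rewrite uv // mulN1r subrr normr0.
by apply/le_anti; rewrite !le // => h /ff'.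
Qed.

End RelativeAmenability.

(** * Separation of points of a compact space *)

Lemma cfun_separates (R : realType) (G : groupType) (X : gspace G) (x y : X) :
  (forall f : cfun R X, f x = f y) -> x = y.
Proof.
move=> fxy; apply: contrapT => nxy.
have cX := @gspace_compact G X; have hX := @gspace_hausdorff G X.
have nX := compact_normal hX cX.
have c1 (z : X) : closed [set z].
  exact/accessible_closed_set1/hausdorff_accessible.
have us : uniform_separator [set x] [set y].
  apply: normal_uniform_separator => //.
  by apply/seteqP; split=> // z [/= -> /nxy].
pose u : X -> R := Urysohn [set x] [set y].
have cu : continuous u by exact: Urysohn_continuous.
have ux : u x = 0 by apply: (Urysohn_sub0 us); exists x.
have uy : u y = 1 by apply: (Urysohn_sub1 us); exists y.
have cc : continuous (fun z => (u z)%:C : R[i]^o).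
  move=> z; apply/cvgrPdist_lt => e e0.
  have eE : e = (complex.Re e)%:C by rewrite RRe_real // ger0_real // ltW.
  have := cu z; move/cvgrPdist_lt => /(_ (complex.Re e)) H.
  have : 0 < complex.Re e by rewrite -ltcR -eE.
  move=> /H; apply: filterS => w.
  by rewrite -rmorphB /= norm_realC [in X in _ -> X]eE ltcR.
have := fxy (CFun (mem_set cc)); rewrite /= ux uy => /eqP.
by rewrite eq_complex /= eq_sym oner_eq0.
Qed.

(** * Poisson transforms *)

Lemma g_ucp_comp (G : groupType) (R : realType) (S T U : gopsystem G R)
  (f : T -> U) (h : S -> T) : g_ucp f -> g_ucp h -> g_ucp (f \o h).
Proof.
move=> [uf ef] [uh eh]; split=> [|g a]; last by rewrite /= eh ef.
split=> [c a b||n A pA] /=.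
- by rewrite (ucp_linear uh) (ucp_linear uf).
- by rewrite (ucp_unit uh) (ucp_unit uf).
- by rewrite map_mx_comp; apply: (ucp_pos uf); exact: (ucp_pos uh).
Qed.

Section PoissonTransform.
Context {G : groupType} {R : realType} {I : gopsystem G R} {Z : Type}.
Variable sigma : Z -> I -> R.
Hypothesis sigma_state : forall z, real_state (sigma z).

(** The inverse makes the map equivariant for left translation of [G]. *)
Definition poisson (a : I) : translation_gopsystem R G Z.
Proof.
apply: (@BFun _ _ (fun d => complexify (sigma d.2) (gact d.1^-1%g a))).
rewrite inE /=; have [r ra] := complexify_bound a; exists r => d.
have ug := @gact_ucp G R I d.1^-1%g.
by rewrite complexify_comp //; apply: ra; exact: rs_comp.
Defined.

Lemma poisson_g_ucp : g_ucp poisson.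
Proof.
split; last first.
  move=> g a; apply/val_inj/funext => d /=.
  by rewrite -gactM invgM invgK.
split=> [c a b||n A pA d].
- apply/val_inj/funext => d /=.
  have ug := @gact_ucp G R I d.1^-1%g.
  by rewrite (ucpD ug) (ucpZ _ _ ug) complexifyD // complexifyZ.
- apply/val_inj/funext => d /=.
  have ug := @gact_ucp G R I d.1^-1%g.
  by rewrite (ucp_unit ug) complexify_unit.
- have ug := @gact_ucp G R I d.1^-1%g.
  have := complexify_psd (sigma_state d.2) (ucp_pos ug pA).
  by congr psdmx; apply/matrixP => i j; rewrite !mxE.
Qed.

End PoissonTransform.

(** * The subgroup acting trivially *)

Section TrivialPart.
Context {G : groupType} {R : realType} (I : gopsystem G R).

Definition state_space := {tau : I -> R | real_state tau}.

Definition trivial_part : set G := action_kernel (@gact G R I) [set: I].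

Lemma trivial_part_normal : normal_subgroup trivial_part.
Proof. by apply: action_kernel_normal; [exact: gact1|exact: gactM]. Qed.

Lemma trivial_partV g (a : I) : trivial_part g -> gact g^-1%g a = a.
Proof. by move=> /(nsgV trivial_part_normal); exact. Qed.

Lemma spectrum_kernel (cs : comm_gcstar I) :
  action_kernel (@spectrum_act G R I) (spectrum cs) = trivial_part.
Proof.
apply/seteqP; split=> g /=; last first.
  move=> tg chi _; apply/funext => a; rewrite /spectrum_act.
  by rewrite trivial_partV.
move=> kg a _; suff V (b : I) : gact g^-1%g b = b.
  by rewrite -[in LHS](V a) -gactM mulgV gact1.
apply: subr0_eq; apply: (states_separate (cs := cs)) => tau st sp.
rewrite complexifyD // -scaleN1r complexifyZ // mulN1r.
have /(congr1 (fun chi => chi b)) := kg _ sp; rewrite /spectrum_act => ->.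
by rewrite subrr.
Qed.

End TrivialPart.

(** * The injective envelope *)

Section Envelope.
Context {R : realType} {G : groupType} {X : gspace G} {I : gopsystem G R}.
Variables (kappa : cfun_gopsystem R X -> I) (cs : comm_gcstar I).
Hypothesis env : g_injective_envelope kappa.

Let uk : ucp kappa := emb_ucp (genv_embedding env).1.

(** A kernel element and its opposite are both positive, as [kappa] reflects
    positivity. *)
Lemma kappa_inj f g : kappa f = kappa g -> f = g.
Proof.
move=> E; apply: subr0_eq.
have E0 : kappa (f - g) = 0.
  by rewrite (ucpD uk) (ucpN _ uk) E subrr.
have h0 : hpos (0 : I).
  by rewrite -(scale0r (ounit I)); apply: (hposZ (lexx 0)); exact: hpos_unit.
have refl h : kappa h = 0 -> hpos h.
  move=> h00; apply: (emb_reflect (genv_embedding env).1).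
  by rewrite [X in mpos X]mx11_const !mxE h00.
by apply: hpos_proper; apply: refl; rewrite ?(ucpN _ uk) ?E0 ?oppr0.
Qed.

Lemma kappa_hpos f :
  (forall tau, real_state tau -> 0 <= complexify tau (kappa f)) -> hpos f.
Proof.
move=> pf; apply: (emb_reflect (genv_embedding env).1).
by rewrite [X in mpos X]mx11_const !mxE; exact: (hpos_of_states cs).
Qed.

Lemma cfun_hpos (f : cfun_gopsystem R X) x :
  hpos f -> 0 <= (f : cfun R X) x :> R[i].
Proof.
move=> /(_ x)[_ /(_ (fun=> 1))].
by rewrite /qform !big_ord1 !mxE rmorph1 mul1r mulr1.
Qed.

(** The content is that positivity is reflected.  Evaluation at [1%g] shows that
    every state makes [map_mx kappa A] positive semidefinite.  Positivity of [A]
    at a point of [X] is that of its quadratic forms, each of which is the value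
    of one element of C(X); so no positivity test for matrices over [I] is
    needed beyond the case of single elements. *)
Lemma poisson_embedding :
  g_embedding (poisson (fun z : state_space I => svalP z) \o kappa).
Proof.
have gk : g_ucp kappa by have [[]] := genv_embedding env.
have [uj ej] := g_ucp_comp (poisson_g_ucp (fun z : state_space I => svalP z)) gk.
split=> //; split=> // n A pA.
have st tau (s : real_state tau) :
    psdmx (map_mx (complexify tau) (map_mx kappa A)).
  have := pA (1%g, exist _ tau s).
  by congr psdmx; apply/matrixP => i j; rewrite !mxE /= invg1 gact1.
have hA : hermitian_mx (@star R (cfun_gopsystem R X)) A.
  move=> i j; apply: kappa_inj; rewrite (ucp_star _ uk); apply: subr0_eq.
  apply: (states_separate (cs := cs)) => tau s _.
  rewrite complexifyD // -scaleN1r complexifyZ // mulN1r complexify_star //.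
  by have [/(_ i j)] := st _ s; rewrite !mxE => ->; rewrite subrr.
move=> x; split=> [i j|v].
  by rewrite !mxE hA.
pose b : cfun_gopsystem R X := \sum_k \sum_l ((v k)^* * v l) *: A k l.
have kb : kappa b = \sum_k \sum_l ((v k)^* * v l) *: (map_mx kappa A) k l.
  rewrite (big_morph _ (ucpD uk) (ucp0 uk)); apply: eq_bigr => k _.
  rewrite (big_morph _ (ucpD uk) (ucp0 uk)); apply: eq_bigr => l _.
  by rewrite (ucpZ _ _ uk) mxE.
have : hpos b.
  apply: kappa_hpos => tau s; rewrite kb complexify_quadratic //.
  exact: (st _ s).2.
move=> /(cfun_hpos x); rewrite /b cfun_sum; congr (0 <= _).
apply: eq_bigr => k _; rewrite cfun_sum; apply: eq_bigr => l _.
by rewrite mxE mulrAC.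
Qed.

(** Without states [kappa_hpos] would make [-1] positive in C(X). *)
Lemma states_nonempty : exists tau : I -> R, real_state tau.
Proof.
apply: contrapT => nost.
have : hpos (- ounit (cfun_gopsystem R X)).
  by apply: kappa_hpos => tau st; case: nost; exists tau.
by move=> /(cfun_hpos point); rewrite /= oppr_ge0 ler10.
Qed.

Lemma equivariant_extension :
  exists2 Psi : translation_gopsystem R G (state_space I) -> I, g_ucp Psi &
    forall f, Psi (poisson (fun z : state_space I => svalP z) (kappa f)) = kappa f.
Proof.
apply: (genv_injective env poisson_embedding).
by have [[]] := genv_embedding env.
Qed.

(** The value [0] on unbounded functions is irrelevant, as means are only
    constrained on bounded ones. *)
Definition lift_fun (f : G -> R) : bfun R (G * state_space I) :=
  insubd 0 (fun d => (f d.1)%:C : R[i]^o).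

Lemma lift_funE f : bounded_on setT f ->
  forall d, lift_fun f d = (f d.1)%:C.
Proof.
move=> [r fr] d; rewrite /lift_fun -[LHS]/(val (insubd _ _) d) insubdK //.
by rewrite inE; exists r => e; rewrite norm_realC lecR; exact: fr.
Qed.

(** [Psi] intertwines translation by [h] with the action of [h] on [I]; for [h]
    acting trivially, [Psi] is therefore invariant under translation by [h]. *)
Lemma trivial_part_amenable : amenable R (trivial_part I).
Proof.
have [Psi [uPsi ePsi] _] := equivariant_extension.
have [tau st] := states_nonempty.
apply: (@amenable_of_relative_mean R G _ setT (fun f => tau (Psi (lift_fun f)))).
- exact: (trivial_part_normal I).
- by [].
have bT f r : (forall x, `|f x| <= r) -> bounded_on setT (f : G -> R).
  by move=> fr; exists r.
split=> [f f' bf bf'|k f bf|f bf f0||h f th bf].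
- have [r fr] := bf; have [s f's] := bf'.
  rewrite -(rs_add st) -(ucpD uPsi); congr (tau (Psi _)); apply/val_inj/funext => d.
  rewrite /= [LHS]lift_funE; last first.
    apply: (bT _ (r + s)) => x.
    by rewrite (le_trans (ler_normD _ _)) // lerD ?fr ?f's.
  by rewrite rmorphD /=; congr (_ + _); rewrite lift_funE.
- have [r fr] := bf.
  rewrite -(rs_scale st) -(ucpZ _ _ uPsi); congr (tau (Psi _)).
  apply/val_inj/funext => d.
  rewrite /= [LHS]lift_funE; last first.
    by apply: (bT _ (`|k| * r)) => x; rewrite normrM ler_wpM2l ?fr.
  by rewrite rmorphM /=; congr (_ * _); rewrite lift_funE.
- apply: (rs_ge0 st); apply: (ucp_hpos uPsi) => d.
  split=> [i j|v]; rewrite /qform ?big_ord1 !mxE lift_funE ?conjC_real //.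
  rewrite mulrAC -normCKC mulr_ge0 ?exprn_ge0 // lecR; exact: f0.
- rewrite -[RHS](rs_unit st) -(ucp_unit uPsi); congr (tau (Psi _)).
  apply/val_inj/funext => d; rewrite [LHS]lift_funE; first by [].
  by apply: (bT (fun=> 1) 1) => x; rewrite normr1.
- rewrite -[in RHS](trivial_partV (Psi _) th) -ePsi.
  congr (tau (Psi _)); apply/val_inj/funext => d /=.
  have [r fr] := bf; rewrite [LHS]lift_funE; last by apply: (bT _ r) => x; exact: fr.
  by rewrite lift_funE //= invgK.
Qed.

(** Urysohn's lemma, through [cfun_separates], brings the triviality of the
    action from C(X) down to [X]. *)
Lemma trivial_part_fixes_space :
  trivial_part I `<=` action_kernel (@gmove G X) [set: X].
Proof.
move=> g tg x _; apply: (@cfun_separates R) => f.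
have : cfun_act g^-1%g f = f.
  apply: kappa_inj; rewrite -[in RHS](trivial_partV (kappa f) tg).
  exact: (genv_embedding env).2.
by move=> /(congr1 (fun h : cfun R X => h x)) /=; rewrite invgK.
Qed.

(** Averaging over [N] produces [N]-invariant states, and their values on C(X)
    do not change since [N] acts trivially there.  Rigidity then recovers every
    element of [I] from these averages. *)
Lemma amenable_sub_trivial_part (N : set G) : normal_subgroup N ->
  amenable R N -> N `<=` action_kernel (@gmove G X) [set: X] ->
  N `<=` trivial_part I.
Proof.
move=> nN [m mN] NX.
pose avg (tau : I -> R) a := m (fun n => tau (gact n^-1%g a)).
have bd (tau : I -> R) (st : real_state tau) a : bounded_on N (fun n => tau (gact n^-1%g a)).
  have [r ra] := rs_bound a; exists r => n _.
  exact: (ra _ (rs_comp st (@gact_ucp G R I n^-1%g))).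
have avg_state (tau : I -> R) : real_state tau -> real_state (avg tau).
  move=> st; have su n := rs_comp st (@gact_ucp G R I n^-1%g).
  split=> [a b|r a|a||a pa]; rewrite /avg.
  - rewrite -(im_add mN); try exact: bd.
    by congr m; apply/funext => n; exact: (rs_add (su n)).
  - rewrite -(im_scale mN); last exact: bd.
    by congr m; apply/funext => n; exact: (rs_scale (su n)).
  - by congr m; apply/funext => n; exact: (rs_star (su n)).
  - rewrite -[RHS](im_one mN).
    by congr m; apply/funext => n; exact: (rs_unit (su n)).
  - by apply: (im_ge0 mN); [exact: bd|move=> n _; exact: (rs_ge0 (su n))].
have avg_inv (tau : I -> R) h a : real_state tau -> N h -> avg tau (gact h a) = avg tau a.
  move=> st Nh; rewrite /avg -(im_inv mN (nsgV nN Nh) (bd _ st a)).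
  by congr m; apply/funext => n; rewrite -gactM invgM invgK.
have avg_kappa (tau : I -> R) f : real_state tau -> avg tau (kappa f) = tau (kappa f).
  move=> st; rewrite /avg (mean_eq_on (f' := fun=> tau (kappa f)) mN (bd _ st _)).
    rewrite -[X in m (fun=> X)]mulr1 (im_scale mN) ?(im_one mN) ?mulr1 //.
    by exists 1 => n _; rewrite normr1.
  move=> n Nn; rewrite -(genv_embedding env).2; congr (tau (kappa _)).
  by apply/val_inj/funext => x /=; rewrite invgK NX.
have [Psi gPsi PsiP] := equivariant_extension.
pose sigma (z : state_space I) := avg (sval z).
have sigmaP z : real_state (sigma z) := avg_state _ (svalP z).
have fixed : forall b, Psi (poisson sigmaP b) = b.
  apply: (genv_rigid env) => [|f].
    exact: (g_ucp_comp gPsi (poisson_g_ucp sigmaP)).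
  rewrite -[RHS]PsiP; congr Psi; apply/val_inj/funext => d /=.
  rewrite -(genv_embedding env).2 /complexify /sigma.
  by rewrite -(ucpZ _ _ uk) !avg_kappa //; exact: (svalP d.2).
move=> g Ng a _; rewrite -[LHS]fixed -[RHS]fixed; congr Psi.
apply/val_inj/funext => d /=.
have Ng' : N (d.1^-1 * g * d.1)%g.
  by have := nsgJ nN d.1^-1%g Ng; rewrite invgK.
have -> : gact d.1^-1%g (gact g a) = gact (d.1^-1 * g * d.1)%g (gact d.1^-1%g a).
  by rewrite -!gactM -!mulgA mulgV mulg1.
rewrite /complexify /sigma -(ucpZ _ _ (@gact_ucp G R I _)).
by rewrite !(avg_inv _ _ _ (svalP d.2) Ng').
Qed.

End Envelope.

(** * The kernel of the boundary action *)

(* For every G-injective envelope [kappa : C(X) -> I] and every structure [cs]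
   of commutative unital G-C*-algebra on I, the spectrum of I is the
   generalized Furstenberg boundary of X. *)
Theorem proposition4p1 (R : realType) (G : groupType) (X : gspace G)
    (I : gopsystem G R) (kappa : cfun_gopsystem R X -> I) (cs : comm_gcstar I)
    (Rad : set G) :
  countable [set: G] ->
  minimal_gspace X ->
  g_injective_envelope kappa ->
  amenable_radical R Rad ->
  action_kernel (@spectrum_act G R I) (spectrum cs) =
  action_kernel (@gmove G X) [set: X] `&` Rad.
Proof.
move=> _ _ env rad; rewrite spectrum_kernel; apply/seteqP; split=> [g tg|].
  split; first exact: (trivial_part_fixes_space env).
  apply: (arad_largest rad _ _ tg); first exact: trivial_part_normal.
  exact: (trivial_part_amenable cs env).
have nN : normal_subgroup (action_kernel (@gmove G X) [set: X] `&` Rad).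
  apply: normal_subgroupI (arad_normal rad).
  by apply: action_kernel_normal; [exact: gmove1|exact: gmoveM].
apply: (amenable_sub_trivial_part cs env nN); last by move=> g [].
have [m mR] := arad_amenable rad.
apply: (amenable_of_relative_mean (M := Rad) (m := m) nN); first by move=> g [].
case: mR => mD mZ m0 m1 minv; split=> // h f [_ Rh]; exact: minv.
Qed.
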